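(* Let $\mathcal U,\mathcal Y$ be separable Hilbert spaces, let $S\in\mathcal S(\mathcal U,\mathcal Y)$, and let $\mathcal H(S)$ be the de Branges-Rovnyak space $$\mathcal H(S)=\Big\{f\in H^2(\mathcal Y)\colon \|f\|^2_{\mathcal H(S)}:=\sup_{g\in H^2(\mathcal U)}\{\|f+Sg\|^2_{H^2(\mathcal Y)}-\|g\|^2_{H^2(\mathcal U)}\}<\infty\Big\}.$$ Then $\mathcal H(S)$ is isometrically equal to the lifted-norm space $$\mathcal H(S)=\mathcal H^l_{I-T_ST_S^*}.$$ Equivalently, if $\mathcal M(S)$ denotes the pullback space $\mathcal M(S):=\mathcal H^p_{T_S}$, then $\mathcal H(S)$ is the Brangesian complementary space $(\mathcal M(S))^{[\perp]}$ to $\mathcal M(S)$ in $H^2(\mathcal Y)$.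
   Context: $H^2(\mathcal Y)$ is the Hardy space of analytic $\mathcal Y$-valued functions on the open unit disk $\mathbb D$ with square-summable Taylor coefficients; $\mathcal S(\mathcal U,\mathcal Y)$ is the Schur class of analytic functions on $\mathbb D$ with values contractive operators from $\mathcal U$ to $\mathcal Y$. $T_S\colon H^2(\mathcal U)\to H^2(\mathcal Y)$ is the analytic Toeplitz (multiplication) operator $T_S\colon f\mapsto S\cdot f$, a contraction. For $P$ on a Hilbert space $\mathcal H$ with $0\le P\le I$, the lifted-norm space $\mathcal H^l_P$ is $\operatorname{Ran}P^{1/2}$ with norm $\|P^{1/2}x\|_{\mathcal H^l_P}=\|\mathbf Qx\|_{\mathcal H}$, $\mathbf Q$ the orthogonal projection onto $(\operatorname{Ker}P)^\perp$. For a contraction $T\in\mathcal L(\mathcal H_0,\mathcal H)$, the pullback space $\mathcal H^p_T$ is $\operatorname{Ran}T$ with norm $\|Tx\|_{\mathcal H^p_T}=\|\mathbf Qx\|_{\mathcal H_0}$, $\mathbf Q$ the orthogonal projection of $\mathcal H_0$ onto $(\operatorname{Ker}T)^\perp$; it is isometrically equal to $\mathcal H^l_{TT^*}$. If $\mathcal M$ is a Hilbert space contractively included in $\mathcal H$, with inclusion $\iota$, and $P=\iota\iota^*$ (so that $\mathcal M=\mathcal H^l_P$), its Brangesian complementary space in $\mathcal H$ is $\mathcal M^{[\perp]}:=\mathcal H^l_{I-P}$. ''Isometrically equal'' means equal as sets with equal norms. *)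

(* Defs.v *)
From HB Require Import structures.
From mathcomp Require Import all_boot all_order all_algebra.
From mathcomp Require Import all_classical all_reals all_analysis.
From mathcomp Require Import complex.
From mathcomp Require Import ring lra.

Set Implicit Arguments.
Unset Strict Implicit.
Unset Printing Implicit Defensive.

Import Order.TTheory GRing.Theory Num.Theory.
Import numFieldNormedType.Exports.

Local Open Scope classical_set_scope.
Local Open Scope complex_scope.
Local Open Scope ring_scope.

Section DotCauchySchwarz.
Variables (C : numClosedFieldType) (V : lmodType C).
Variable form : {dot V for (@Num.conj C)}.

Lemma dot_CauchySchwarz u v : `|form u v| ^+ 2 <= form u u * form v v.
Proof.
have [->|nz_v] := eqVneq v 0.
  by rewrite !linear0r normr0 expr0n.
have vv : form v v != 0 by rewrite dnorm_eq0.
without loss ou: u / form u v = 0.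
  move=> IHo; pose a := form u v / form v v; pose u1 := u - a *: v.
  have ou : form u1 v = 0.
    by rewrite linearBl/= linearZl_LR /= divfK ?subrr.
  have -> : u = u1 + a *: v by rewrite subrK.
  have ou' : form u1 (a *: v) = 0 by rewrite linearZr_LR/= ou mulr0.
  rewrite hnormDd //= linearDl/= ou add0r linearZl_LR/= normrM exprMn.
  rewrite (ger0_norm (dnorm_ge0 _ _)) dnormZ mulrDl expr2 mulrA.
  by rewrite -mulrA -expr2 mulrA lerDr mulr_ge0 // dnorm_ge0.
by rewrite ou normr0 expr0n mulr_ge0 // dnorm_ge0.
Qed.

Lemma ler_sqrt_dnormD u v :
  sqrtC (form (u + v) (u + v)) <= sqrtC (form u u) + sqrtC (form v v).
Proof.
have u0 := dnorm_ge0 form u; have v0 := dnorm_ge0 form v.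
have uv0 := dnorm_ge0 form (u + v).
rewrite -(@ler_pXn2r _ 2) ?nnegrE ?addr_ge0 ?sqrtC_ge0 //.
rewrite sqrtCK sqrrD !sqrtCK dnormD /= [leRHS]addrAC lerD2l.
have -> : form u v + (form u v)^* = 'Re (form u v) *+ 2.
  by rewrite ReE mulr2n -mulrDr; field.
rewrite lerMn2r /=.
apply: (le_trans (leif_Re_Creal _)).

rewrite -(@ler_pXn2r _ 2) ?nnegrE ?mulr_ge0 ?sqrtC_ge0 //.
by rewrite exprMn !sqrtCK dot_CauchySchwarz.
Qed.

End DotCauchySchwarz.

HB.mixin Record NormedModule_isHilbert (R : realType) H
    & CompleteNormedModule R[i] H := {
  hdot : {dot H for (@Num.conj R[i])} ;
  hdotxx : forall x : H, hdot x x = `|x| ^+ 2 }.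

#[short(type="hilbertType")]
HB.structure Definition Hilbert (R : realType) :=
  {H of NormedModule_isHilbert R H & CompleteNormedModule R[i] H}.

(* The norm of a normed module over R[i] takes its values in R[i];
   hnorm is the same number seen in R. *)
Definition hnorm (R : realType) (H : normedModType R[i]) (x : H) : R :=
  complex.Re `|x|.

Section HnormTheory.
Variables (R : realType) (H : normedModType R[i]).
Implicit Types x y : H.

Lemma hnormE x : (hnorm x)%:C = `|x|.
Proof. by apply: RRe_real; rewrite normr_real. Qed.

Lemma hnorm_ge0 x : 0 <= hnorm x.
Proof. by rewrite -ler0c hnormE. Qed.

Lemma hnorm_zero : hnorm (0 : H) = 0.
Proof. by rewrite /hnorm normr0. Qed.

Lemma hnorm_opp x : hnorm (- x) = hnorm x.
Proof. by rewrite /hnorm normrN. Qed.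

Lemma ler_hnormD x y : hnorm (x + y) <= hnorm x + hnorm y.
Proof. by rewrite -lecR rmorphD /= !hnormE ler_normD. Qed.

Lemma hnormZ (c : R[i]) x : hnorm (c *: x) = complex.Re `|c| * hnorm x.
Proof.
apply: complexI; rewrite rmorphM !hnormE normrZ; congr (_ * _).
by apply/esym/RRe_real; rewrite normr_real.
Qed.

Lemma sqr_hnormD x y :
  hnorm (x + y) ^+ 2 <= 2 * hnorm x ^+ 2 + 2 * hnorm y ^+ 2.
Proof.
have := ler_hnormD x y; have := hnorm_ge0 (x + y).
move: (hnorm (x + y)) (hnorm x) (hnorm y) => a b c a0 abc.
have : a ^+ 2 <= (b + c) ^+ 2 by rewrite lerXn2r // nnegrE (le_trans a0).
by have := sqr_ge0 (b - c); lra.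
Qed.

End HnormTheory.

Section SquareSummable.
Variable R : realType.

Definition square_summable (V : normedModType R[i]) (a : nat -> V) :=
  cvgn (series (fun k => hnorm (a k) ^+ 2)).

Lemma cvg_series_lin (c d : R) (u v : nat -> R) (l m : R) :
  series u @ \oo --> l -> series v @ \oo --> m ->
  series (fun k => c * u k + d * v k) @ \oo --> c * l + d * m.
Proof.
move=> ul vm.
have -> : series (fun k => c * u k + d * v k) =
    (fun n => c * series u n + d * series v n).
  by apply/funext => n; rewrite /series /= big_split /= -!mulr_sumr.
by apply: cvgD; (apply: cvgM; first exact: cvg_cst).
Qed.

Lemma is_cvg_series_lin (c d : R) (u v : nat -> R) :
  cvgn (series u) -> cvgn (series v) ->
  cvgn (series (fun k => c * u k + d * v k)).
Proof.
move=> /cvg_ex[l ul] /cvg_ex[m vm].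
by apply: cvgP; apply: cvg_series_lin; [exact: ul|exact: vm].
Qed.

Arguments cvg_series_lin : clear implicits.
Arguments cvg_series_lin c d {u v l m} _ _.
Arguments is_cvg_series_lin : clear implicits.
Arguments is_cvg_series_lin c d {u v} _ _.

Lemma square_summableD (V : normedModType R[i]) (a b : nat -> V) :
  square_summable a -> square_summable b ->
  square_summable (fun k => a k + b k).
Proof.
move=> sa sb; rewrite /square_summable.
have := is_cvg_series_lin 2 2 sa sb; apply: series_le_cvg => n.
- by rewrite exprn_ge0 // hnorm_ge0.
- by rewrite addr_ge0 // mulr_ge0 // exprn_ge0 // hnorm_ge0.
- exact: sqr_hnormD.
Qed.

Lemma square_summableZ (V : normedModType R[i]) (c : R[i]) (a : nat -> V) :
  square_summable a -> square_summable (fun k => c *: a k).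
Proof.
move=> sa; rewrite /square_summable.
have := is_cvg_series_lin (complex.Re `|c| ^+ 2) 0 sa sa.
rewrite (_ : (fun k => _ * _ + _) = (fun k => hnorm (c *: a k) ^+ 2)) //.
by apply/funext => k; rewrite mul0r addr0 hnormZ exprMn.
Qed.

Lemma square_summable0 (V : normedModType R[i]) :
  square_summable (fun=> 0 : V).
Proof.
apply: (@cvgP _ _ (0 : R)); rewrite (_ : series _ = fun=> 0); first exact: cvg_cst.
apply/funext => n; rewrite /series /= big1 // => k _.
by rewrite hnorm_zero expr0n.
Qed.

Lemma square_summable_le (V : normedModType R[i]) (a : nat -> V) (M : R) :
  (forall n, \sum_(0 <= k < n) hnorm (a k) ^+ 2 <= M) -> square_summable a.
Proof.
move=> aM; apply: nondecreasing_is_cvgn; last first.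
  by exists M => _ [n _ <-]; exact: aM.
by apply: nondecreasing_series => k _; rewrite exprn_ge0 // hnorm_ge0.
Qed.

Lemma square_summable_sum_le (V : normedModType R[i]) (a : nat -> V) n :
  square_summable a -> 
  \sum_(0 <= k < n) hnorm (a k) ^+ 2 <=
    limn (series (fun k => hnorm (a k) ^+ 2)).
Proof.
move=> sa; apply: (nondecreasing_cvgn_le _ sa).
by apply: nondecreasing_series => k _; rewrite exprn_ge0 // hnorm_ge0.
Qed.

Lemma square_summable_bounded (V : normedModType R[i]) (a : nat -> V) :
  square_summable a -> exists2 M : R, 0 < M & forall k, hnorm (a k) <= M.
Proof.
move=> sa; exists (limn (series (fun k => hnorm (a k) ^+ 2)) + 1).
  by have := square_summable_sum_le 0 sa; rewrite big_geq // => ?; lra.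
move=> k; have := square_summable_sum_le k.+1 sa.
rewrite big_nat_recr //=.
have : 0 <= \sum_(0 <= i < k) hnorm (a i) ^+ 2.
  by apply: sumr_ge0 => i _; rewrite exprn_ge0 // hnorm_ge0.
have := hnorm_ge0 (a k); move: (hnorm (a k)) (bigop _ _ _) (limn _) => x S L.
by move=> x0 S0 SL; nra.
Qed.

Definition csum (u : nat -> R[i]) : R[i] :=
  limn (series (fun k => complex.Re (u k))) +i*
  limn (series (fun k => complex.Im (u k))).

Definition csummable (u : nat -> R[i]) :=
  cvgn (series (fun k => complex.Re (u k))) /\
  cvgn (series (fun k => complex.Im (u k))).

Lemma csumP (c : R[i]) u v : csummable u -> csummable v ->
  csum (fun k => c * u k + v k) = c * csum u + csum v.
Proof.
move=> [ru iu] [rv iv]; rewrite /csum.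
have h1 := cvg_series_lin (complex.Re c) (- complex.Im c) ru iu.
have h2 := cvg_series_lin (complex.Re c) (complex.Im c) iu ru.
have {}h1 := cvg_series_lin 1 1 h1 rv.
have {}h2 := cvg_series_lin 1 1 h2 iv.
rewrite (_ : (fun k => complex.Re (c * u k + v k)) =
   (fun x => 1 * (complex.Re c * complex.Re (u x) +
      - complex.Im c * complex.Im (u x)) + 1 * complex.Re (v x))); last first.
  by apply/funext => k; case: (c) (u k) (v k) => [? ?] [? ?] [? ?] /=; ring.
rewrite (_ : (fun k => complex.Im (c * u k + v k)) =
   (fun x => 1 * (complex.Re c * complex.Im (u x) +
      complex.Im c * complex.Re (u x)) + 1 * complex.Im (v x))); last first.
  by apply/funext => k; case: (c) (u k) (v k) => [? ?] [? ?] [? ?] /=; ring.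
rewrite (cvg_lim _ h1) // (cvg_lim _ h2) //.
by apply/eqP; rewrite eq_complex; case: c {h1 h2} => ? ? /=; rewrite !mul1r !mulNr !eqxx.
Qed.

Lemma csum_conj u : csummable u ->
  csum (fun k => (u k)^*%C) = (csum u)^*%C.
Proof.
move=> [ru iu]; have h := cvg_series_lin (-1) 0 iu iu.
have e : (fun k => complex.Im (u k)^*%C) =
   (fun k => -1 * complex.Im (u k) + 0 * complex.Im (u k)).
  by apply/funext => k; case: (u k) => ? ? /=; ring.
have e' : (fun k => complex.Re (u k)^*%C) = (fun k => complex.Re (u k)).
  by apply/funext => k; case: (u k).
rewrite /csum e e' (cvg_lim _ h) //=.
by congr (_ +i* _); ring.
Qed.

Lemma csum_real (r : nat -> R) :
  csum (fun k => (r k)%:C) = (limn (series r))%:C.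
Proof.
rewrite /csum /=; congr (_ +i* _).
rewrite (_ : series _ = fun=> 0); first exact: lim_cst.
by apply/funext => n; rewrite /series /= big1.
Qed.

End SquareSummable.
Arguments square_summableZ {R V} c {a} _.
Arguments is_cvg_series_lin {R} c d {u v} _ _.

Section HdotSummable.
Variables (R : realType) (H : hilbertType R).

Lemma hdotxx_hnorm (x : H) : hdot x x = (hnorm x ^+ 2)%:C.
Proof. by rewrite rmorphXn /= hnormE hdotxx. Qed.

Lemma Re_Im_hdot_le (x y : H) :
  `|complex.Re (hdot x y)| <= hnorm x ^+ 2 + hnorm y ^+ 2 /\
  `|complex.Im (hdot x y)| <= hnorm x ^+ 2 + hnorm y ^+ 2.
Proof.
have := dot_CauchySchwarz hdot x y.
rewrite !hdotxx_hnorm -rmorphM /= -add_Re2_Im2 lecR.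
have := hnorm_ge0 x; have := hnorm_ge0 y.
move: (hnorm x) (hnorm y) (complex.Re _) (complex.Im _) => a b r i b0 a0 h.
have [r2 i2] := (sqr_ge0 r, sqr_ge0 i).
have ab0 : 0 <= a ^+ 2 + b ^+ 2 by rewrite addr_ge0 // sqr_ge0.
have abh : a ^+ 2 * b ^+ 2 <= (a ^+ 2 + b ^+ 2) ^+ 2 by nra.
split; rewrite -(@ler_pXn2r _ 2) ?nnegrE // real_normK ?num_real //; lra.
Qed.

Lemma csummable_hdot (a b : nat -> H) :
  square_summable a -> square_summable b ->
  csummable (fun k => hdot (a k) (b k)).
Proof.
move=> sa sb; have h := is_cvg_series_lin 1 1 sa sb.
split; apply: normed_cvg; apply: series_le_cvg h => k //=;
  rewrite ?mul1r; by [rewrite addr_ge0 ?sqr_ge0 |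
                      have [] := Re_Im_hdot_le (a k) (b k)].
Qed.

End HdotSummable.

Definition unit_disk (R : realType) := {z : R[i] | `|z| < 1}.

Definition has_power_series (R : realType) (V : normedModType R[i])
    (a : nat -> V) (f : unit_disk R -> V) :=
  forall z, series (fun k => val z ^+ k *: a k) @ \oo --> f z.

Section PowerSeries.
Variables (R : realType) (V : normedModType R[i]).
Implicit Types (a b : nat -> V) (f g : unit_disk R -> V).

Lemma hnorm_sum_le (u : nat -> V) m n :
  hnorm (\sum_(m <= k < n) u k) <= \sum_(m <= k < n) hnorm (u k).
Proof.
elim/big_ind2 : _ => [|x x' y y' xx' yy'|//].
  by rewrite hnorm_zero.
by apply: le_trans (ler_hnormD _ _) _; rewrite lerD.
Qed.

Lemma ler_sum_geom (q : R) m n : 0 <= q -> q <= 2^-1 ->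
  \sum_(m <= k < n) q ^+ k <= 2 * q ^+ m.
Proof.
move=> q0 q2; have [mn|mn] := leqP m n; last first.
  by rewrite big_geq ?mulr_ge0 ?exprn_ge0 // ltnW.
suff : \sum_(m <= k < n) q ^+ k <= 2 * q ^+ m - 2 * q ^+ n.
  by have := exprn_ge0 n q0; lra.
elim: n mn => [|n IHn]; first by rewrite leqn0 => /eqP ->; rewrite big_geq //; lra.
rewrite leq_eqVlt => /predU1P[->|]; first by rewrite big_geq //; lra.
rewrite ltnS => mn; rewrite big_nat_recr //= exprS.
by have := exprn_ge0 n q0; have := IHn mn; nra.
Qed.

Lemma real_disk (t : R) : 0 <= t -> t < 1 ->
  exists z : unit_disk R, val z = t%:C.
Proof.
move=> t0 t1; have t1' : `|t%:C| < 1 :> R[i].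
  by rewrite ger0_norm ?ler0c // (_ : 1 = 1%:C) // ltcR.
by exists (exist (fun z : R[i] => `|z| < 1) _ t1').
Qed.

Lemma hnorm_realZ (t : R) k (x : V) : 0 <= t ->
  hnorm (t%:C ^+ k *: x) = t ^+ k * hnorm x.
Proof.
by move=> t0; rewrite hnormZ -rmorphXn ger0_norm //= ?ler0c ?exprn_ge0.
Qed.

Lemma cvg_hnorm_lt (u : nat -> V) (l : V) (e : R) : u @ \oo --> l -> 0 < e ->
  \forall n \near \oo, hnorm (l - u n) < e.
Proof.
move=> /cvgrPdist_lt ul e0; have /ul : 0 < e%:C by rewrite ltcR.
by apply: filterS => n; rewrite -hnormE ltcR.
Qed.

Lemma power_series_coef_bound a f : has_power_series a f ->
  exists2 M : R, 0 < M & forall k, hnorm (a k) <= M * 2 ^+ k.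
Proof.
move=> af; have h0 : 0 <= 2^-1 :> R by lra.
have h1 : 2^-1 < 1 :> R by lra.
have [z zE] := real_disk h0 h1.
have := cvg_series_cvg_0 (cvgP _ (af z)); rewrite zE.
move=> /cvg_hnorm_lt /(_ ltr01)[N _ hN].
pose S := \sum_(0 <= k < N) hnorm ((2^-1)%:C ^+ k *: a k).
have S0 : 0 <= S by apply: sumr_ge0 => k _; exact: hnorm_ge0.
exists (1 + S) => [|k]; first lra.
suff : hnorm ((2^-1)%:C ^+ k *: a k) <= 1 + S.
  by rewrite hnorm_realZ // exprVn mulrC ler_pdivrMr.
have [kN|Nk] := ltnP k N; last first.
  have := hN k Nk; rewrite /= sub0r hnorm_opp => /ltW /le_trans; apply.
  lra.
rewrite (le_trans (_ : _ <= S)) ?lerDr //.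
rewrite /S (big_cat_nat (n := k)) //=; last exact: ltnW.
rewrite [X in _ <= _ + X]big_ltn //.
rewrite addrCA lerDl addr_ge0 // sumr_ge0 // => i _; exact: hnorm_ge0.
Qed.

Lemma power_series0 a : has_power_series a (fun=> 0) -> forall n, a n = 0.
Proof.
move=> a0; have [M M0 aM] := power_series_coef_bound a0.
elim/ltn_ind => n IHn; apply/eqP; apply: contrapT => /negP an.
have c0 : 0 < hnorm (a n).
  by rewrite -ltcR hnormE normr_gt0.
set c := hnorm (a n) in c0.
have M2 : 0 < M * 2 ^+ n by rewrite mulr_gt0 // exprn_gt0.
pose t := Num.min (4^-1) (c / (8 * (M * 2 ^+ n))).
have t0 : 0 < t by rewrite lt_min divr_gt0 ?andbT //; lra.
have t4 : t <= 4^-1 by rewrite ge_min lexx.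
have tc : M * 2 ^+ n * (4 * t) <= c / 2.
  have : t <= c / (8 * (M * 2 ^+ n)) by rewrite ge_min lexx orbT.
  rewrite ler_pdivlMr; last by rewrite mulr_gt0.
  by lra.
have t1 : t < 1 by lra.
have e0 : 0 < t ^+ n * (c / 2) by rewrite mulr_gt0 ?exprn_gt0 // divr_gt0.
have [z zE] := real_disk (ltW t0) t1.
have := cvg_hnorm_lt (a0 z) e0; rewrite zE.
move=> [N _ /(_ (maxn N n.+1))] /=; rewrite leq_maxl => /(_ isT).
set m := maxn N n.+1; have nm : (n.+1 <= m)%N by rewrite leq_maxr.
apply/negP; rewrite -leNgt sub0r hnorm_opp /series /=.
rewrite (big_cat_nat (n := n)) //=; last exact: ltnW.
rewrite big_nat big1 ?add0r; last by move=> i /IHn ->; rewrite scaler0.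
rewrite big_ltn //.
set T := (X in _ + X).
have : hnorm T <= t ^+ n * (c / 2).
  apply: le_trans (hnorm_sum_le _ _ _) _.
  apply: (@le_trans _ _ (\sum_(n.+1 <= i < m) M * (2 * t) ^+ i)).
    apply: ler_sum => i _; rewrite hnorm_realZ ?(ltW t0) // exprMn mulrA mulrC.
    by rewrite ler_wpM2r // exprn_ge0 // ltW.
  rewrite -mulr_sumr.
  have : \sum_(n.+1 <= i < m) (2 * t) ^+ i <= 2 * (2 * t) ^+ n.+1.
    by apply: ler_sum_geom; lra.
  rewrite -(ler_pM2l M0) => /le_trans; apply.
  rewrite exprS exprMn.
  rewrite [leLHS](_ : _ = t ^+ n * (M * 2 ^+ n * (4 * t))); last by ring.
  by rewrite ler_pM2l // exprn_gt0.
have := ler_hnormD (t%:C ^+ n *: a n + T) (- T).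
rewrite addrK hnorm_realZ ?(ltW t0) // -/c hnorm_opp.
lra.
Qed.

Lemma has_power_seriesD a b f g : has_power_series a f ->
  has_power_series b g -> has_power_series (fun k => a k + b k) (f \+ g).
Proof.
move=> af bg z; rewrite (_ : series _ = series (fun k => val z ^+ k *: a k) \+
    series (fun k => val z ^+ k *: b k)); first exact: cvgD.
apply/funext => n; rewrite /series /= -big_split /=.
by apply: eq_bigr => k _; rewrite scalerDr.
Qed.

Lemma has_power_seriesZ (c : R[i]) a f : has_power_series a f ->
  has_power_series (fun k => c *: a k) (fun z => c *: f z).
Proof.
move=> af z; rewrite (_ : series _ =
    fun n => c *: series (fun k => val z ^+ k *: a k) n).
  exact: cvgZr.
apply/funext => n; rewrite /series /= scaler_sumr.
by apply: eq_bigr => k _; rewrite !scalerA mulrC.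
Qed.

Lemma power_series_uniq a b f :
  has_power_series a f -> has_power_series b f -> a = b.
Proof.
move=> af bf; apply/funext => n; apply/eqP; rewrite -subr_eq0; apply/eqP.
have := has_power_seriesD af (has_power_seriesZ (c := -1) bf).
rewrite (_ : _ \+ _ = fun=> 0).
  by move=> /power_series0 /(_ n); rewrite scaleN1r.
by apply/funext => z /=; rewrite scaleN1r subrr.
Qed.

End PowerSeries.
Arguments has_power_seriesD {R V a b f g} _ _.
Arguments has_power_seriesZ {R V} c {a f} _.
Arguments power_series_uniq {R V a b f} _ _.

Lemma square_summable_power_series (R : realType)
    (V : completeNormedModType R[i]) (a : nat -> V) :
  square_summable a -> exists f, has_power_series a f.
Proof.
move=> sa; suff cz : forall z : unit_disk R,
    cvgn (series (fun k => val z ^+ k *: a k)).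
  by exists (fun z => limn (series (fun k => val z ^+ k *: a k))).
move=> z; pose r := complex.Re `|val z|.
have rE : r%:C = `|val z| by apply: RRe_real; rewrite normr_real.
have r0 : 0 <= r by rewrite -ler0c rE.
have r1 : r < 1 by rewrite -ltcR rE; exact: (valP z).
have [M M0 aM] := square_summable_bounded sa.
have rn : `|r| < 1 by rewrite ger0_norm.
have : cvgn (series (geometric M r)) by exact: is_cvg_geometric_series.
move=> /cauchy_cvgP/cauchy_seriesP geo.
apply/cauchy_cvgP/cauchy_seriesP => e e0.
have eE : e = (complex.Re e)%:C by rewrite RRe_real // gtr0_real.
have /geo : 0 < complex.Re e by rewrite -ltcR -eE.
apply: filterS => -[m n] /= mn; rewrite -hnormE eE ltcR.
apply: le_lt_trans mn; apply: le_trans (hnorm_sum_le _ _ _) _.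
apply: le_trans (ler_norm _); apply: ler_sum => k _.
by rewrite hnormZ normrX -rE -rmorphXn /= mulrC ler_wpM2r // exprn_ge0.
Qed.

(* As in Sz.-Nagy and Foias, an analytic function on the unit disk is the sum
   of a power series at 0 converging on the whole disk; its Taylor coefficients
   are those of the series (unique by power_series_uniq). *)
Definition hardy_pred (R : realType) (Y : hilbertType R) :
    {pred unit_disk R -> Y} :=
  fun f => `[< exists2 a : nat -> Y,
                 has_power_series a f & square_summable a >].
Arguments hardy_pred {R} Y.

Record hardy (R : realType) (Y : hilbertType R) : Type :=
  Hardy { hardy_fun :> unit_disk R -> Y ; _ : hardy_fun \in hardy_pred Y }.

HB.instance Definition _ (R : realType) (Y : hilbertType R) :=
  [isSub of hardy Y for @hardy_fun R Y].
HB.instance Definition _ (R : realType) (Y : hilbertType R) :=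
  [Choice of hardy Y by <:].

Lemma hardy_submod_closed (R : realType) (Y : hilbertType R) :
  submod_closed (hardy_pred Y).
Proof.
split=> [|c f g /asboolP[a af sa] /asboolP[b bg sb]]; apply/asboolP.
  exists (fun=> 0); last exact: square_summable0.
  move=> z; rewrite (_ : series _ = fun=> 0); first exact: cvg_cst.
  by apply/funext => n; rewrite /series /= big1 // => k _; rewrite scaler0.
exists (fun k => c *: a k + b k).
  by move=> z; exact: (has_power_seriesD (has_power_seriesZ c af) bg z).
exact: square_summableD (square_summableZ c sa) sb.
Qed.

HB.instance Definition _ (R : realType) (Y : hilbertType R) :=
  GRing.isSubmodClosed.Build R[i] (unit_disk R -> Y) (hardy_pred Y)
    (@hardy_submod_closed R Y).
HB.instance Definition _ (R : realType) (Y : hilbertType R) :=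
  [SubChoice_isSubLmodule of hardy Y by <:].

Lemma cvg_hnorm (R : realType) (V : normedModType R[i]) (T : Type)
    (F : set_system T) (FF : Filter F) (u : T -> V) (l : V) :
  u @ F --> l -> (fun x => hnorm (u x)) @ F --> hnorm l.
Proof.
move=> /cvgrPdist_lt ul; apply/cvgrPdist_lt => e e0.
have /ul : 0 < e%:C by rewrite ltcR.
apply: filterS => x; rewrite -hnormE ltcR; apply: le_lt_trans.
have := ler_hnormD (l - u x) (u x); have := ler_hnormD (u x - l) l.
rewrite !subrK -(opprB l) hnorm_opp ler_distl => h1 h2.
by apply/andP; split; lra.
Qed.

Section HardyHilbert.
Variables (R : realType) (Y : hilbertType R).
Implicit Types f g : hardy Y.

Definition taylor (f : hardy Y) : nat -> Y :=
  xget (fun=> 0) [set a | has_power_series a f].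

Lemma taylorP f : has_power_series (taylor f) f.
Proof.
have : hardy_fun f \in hardy_pred Y by case: f.
move=> /asboolP[a af _].
exact: (xgetPex (fun=> 0) (ex_intro [set a | has_power_series a f] a af)).
Qed.
Arguments taylorP : clear implicits.

Lemma taylorE f a : has_power_series a f -> taylor f = a.
Proof. exact: power_series_uniq (taylorP f). Qed.

Lemma taylor_summable f : square_summable (taylor f).
Proof.
have : hardy_fun f \in hardy_pred Y by case: f.
by move=> /asboolP[a af sa]; rewrite (taylorE af).
Qed.

Arguments taylor_summable : clear implicits.

Lemma taylorZD (c : R[i]) f g :
  taylor (c *: f + g) = fun k => c *: taylor f k + taylor g k.
Proof.
apply: taylorE => z.
exact: (has_power_seriesD (has_power_seriesZ c (taylorP f)) (taylorP g) z).
Qed.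

Lemma taylorD f g : taylor (f + g) = fun k => taylor f k + taylor g k.
Proof. 
by apply: taylorE => z; exact: (has_power_seriesD (taylorP f) (taylorP g) z).
 Qed.

Lemma taylorB f g : taylor (f - g) = fun k => taylor f k - taylor g k.
Proof.
rewrite -scaleN1r addrC taylorZD.
by apply/funext => k; rewrite scaleN1r addrC.
Qed.

Lemma taylor_inj : injective taylor.
Proof.
move=> f g fg; apply: val_inj; apply/funext => z.
have := taylorP f z; rewrite fg => fz.
by apply: cvg_unique fz (taylorP g z).
Qed.

Lemma csummable_taylor f g :
  csummable (fun k => hdot (taylor f k) (taylor g k)).
Proof. by apply: csummable_hdot; exact: taylor_summable. Qed.

Definition hardy_dot (f g : hardy Y) : R[i] :=
  csum (fun k => hdot (taylor f k) (taylor g k)).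

Lemma hardy_dot_conj f g : hardy_dot f g = Num.conj (hardy_dot g f).
Proof.
rewrite [RHS](_ : _ = (hardy_dot g f)^*%C) //.
rewrite /hardy_dot -csum_conj; last exact: csummable_taylor.
congr csum; apply/funext => k.
by rewrite hermC expr0 mul1r.
Qed.

Lemma hardy_dot_linearl g : GRing.linear_for *%R (hardy_dot ^~ g).
Proof.
move=> c f f'; rewrite /hardy_dot taylorZD.
rewrite -csumP; do ?exact: csummable_taylor.
congr csum; apply/funext => k.
by rewrite linearDl /= linearZl_LR.
Qed.

Lemma hardy_dot_linearr f : GRing.linear_for (Num.conj \; *%R) (hardy_dot f).
Proof.
move=> c g g' /=; rewrite hardy_dot_conj hardy_dot_linearl.
by rewrite rmorphD rmorphM /= -!hardy_dot_conj.
Qed.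

Lemma hardy_dotxx f : hardy_dot f f =
  (limn (series (fun k => hnorm (taylor f k) ^+ 2)))%:C.
Proof.
rewrite -csum_real; congr csum; apply/funext => k.
by rewrite hdotxx_hnorm.
Qed.

Lemma hardy_dot_gt0 f : f != 0 -> 0 < hardy_dot f f.
Proof.
move=> f0; have [n fn] : exists n, taylor f n != 0.
  apply: contrapT => /forallNP f00; move/eqP : f0; apply.
  apply: taylor_inj; apply/funext => n.
  have -> : taylor (0 : hardy Y) n = 0.
    by have := taylorB f f; rewrite subrr => ->; rewrite subrr.
  by apply/eqP; apply: contrapT => /negP /(f00 n).
rewrite hardy_dotxx ltcR.
have := square_summable_sum_le n.+1 (taylor_summable f).
apply: lt_le_trans; rewrite big_nat_recr //= ltr_wpDl //.
  by apply: sumr_ge0 => k _; rewrite exprn_ge0 // hnorm_ge0.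
by rewrite exprn_gt0 // -ltcR hnormE normr_gt0.
Qed.

HB.instance Definition _ := bilinear_isBilinear.Build R[i] (hardy Y) (hardy Y)
  R[i] _ _ hardy_dot (hardy_dot_linearl, hardy_dot_linearr).
HB.instance Definition _ := isHermitianSesquilinear.Build R[i] (hardy Y)
  false Num.conj hardy_dot (fun f g => etrans (hardy_dot_conj f g) (esym (mul1r _))).
HB.instance Definition _ := isDotProduct.Build R[i] (hardy Y) hardy_dot hardy_dot_gt0.

Definition hardy_norm (f : hardy Y) : R[i] := sqrtC (hardy_dot f f).

Lemma ler_hardy_normD f g :
  hardy_norm (f + g) <= hardy_norm f + hardy_norm g.
Proof. exact: (ler_sqrt_dnormD hardy_dot). Qed.

Lemma hardy_normZ (c : R[i]) f : hardy_norm (c *: f) = `|c| * hardy_norm f.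
Proof.
rewrite /hardy_norm (dnormZ hardy_dot) sqrtCM ?nnegrE ?exprn_ge0 //.
by rewrite sqrCK.
Qed.

Lemma hardy_norm_eq0 f : hardy_norm f = 0 -> f = 0.
Proof. by move/eqP; rewrite sqrt_dnorm_eq0 => /eqP. Qed.

HB.instance Definition _ := Lmodule_isNormed.Build R[i] (hardy Y)
  ler_hardy_normD hardy_normZ hardy_norm_eq0.

Lemma hardy_dotxx_norm f : hardy_dot f f = `|f| ^+ 2.
Proof. by rewrite -[RHS]/(hardy_norm f ^+ 2) sqrtCK. Qed.

Lemma sqr_hnorm_hardy f :
  hnorm f ^+ 2 = limn (series (fun k => hnorm (taylor f k) ^+ 2)).
Proof.
by apply: complexI; rewrite -hardy_dotxx hardy_dotxx_norm rmorphXn /= hnormE.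
Qed.

Lemma hnorm_taylor_sum_le f n :
  \sum_(0 <= k < n) hnorm (taylor f k) ^+ 2 <= hnorm f ^+ 2.
Proof.
by rewrite sqr_hnorm_hardy; apply: square_summable_sum_le (taylor_summable f).
Qed.

Lemma hnorm_taylor_le f n : hnorm (taylor f n) <= hnorm f.
Proof.
rewrite -(@ler_pXn2r _ 2) ?nnegrE ?hnorm_ge0 //.
apply: le_trans (hnorm_taylor_sum_le f n.+1).
rewrite big_nat_recr //= lerDr; apply: sumr_ge0 => k _.
by rewrite exprn_ge0 // hnorm_ge0.
Qed.

Lemma hnorm_hardy_le f (M : R) : 0 <= M ->
  (forall n, \sum_(0 <= k < n) hnorm (taylor f k) ^+ 2 <= M ^+ 2) ->
  hnorm f <= M.
Proof.
move=> M0 fM; rewrite -(@ler_pXn2r _ 2) ?nnegrE ?hnorm_ge0 //.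
rewrite sqr_hnorm_hardy; apply: limr_le; first exact: taylor_summable.
by apply: nearW => n; exact: fM.
Qed.

Lemma hardy_complete (F : set_system (hardy Y)) :
  ProperFilter F -> cauchy F -> cvg F.
Proof.
move=> FF /cauchy_ballP Fc.
have Fe (e : R) : 0 < e -> exists2 A, F A &
    forall f g, A f -> A g -> hnorm (f - g) < e.
  move=> e0; have /Fc [[A B] /= [FA FB] AB] : 0 < e%:C by rewrite ltcR.
  exists (A `&` B) => [|f g [Af _] [_ Bg]]; first exact: filterI.
  have := AB (f, g) (conj Af Bg).
  by rewrite /= -ball_normE /= -hnormE ltcR.
have cn n : cvg ((taylor ^~ n) @ F).
  apply/cauchy_cvgP/cauchy_ballP => e e0.
  have eE : e = (complex.Re e)%:C by rewrite RRe_real // gtr0_real.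
  have /Fe[A FA AA] : 0 < complex.Re e by rewrite -ltcR -eE.
  exists ((taylor ^~ n) @` A, (taylor ^~ n) @` A) => /=.
    by split; apply: (@filterS _ F _ A _ _ FA) => f Af; exists f.
  move=> [_ _] [/= [f Af <-] [g Ag <-]].
  rewrite -ball_normE /= -hnormE eE ltcR.
  by have := hnorm_taylor_le (f - g) n; rewrite taylorB => /le_lt_trans; apply; exact: AA.
pose a n := lim ((taylor ^~ n) @ F).
have key (e : R) A : 0 < e -> F A ->
    (forall f g, A f -> A g -> hnorm (f - g) < e) ->
    forall f, A f -> forall n,
    \sum_(0 <= k < n) hnorm (taylor f k - a k) ^+ 2 <= e ^+ 2.
  move=> e0 FA AA f Af n.
  have fa : (fun g => \sum_(0 <= k < n) hnorm (taylor f k - taylor g k) ^+ 2) @ F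
     --> \sum_(0 <= k < n) hnorm (taylor f k - a k) ^+ 2.
    elim: n => [|n IHn].
      rewrite big_geq //; under eq_fun do rewrite big_geq //; exact: cvg_cst.
    rewrite big_nat_recr //=; under eq_fun do rewrite big_nat_recr //=.
    apply: cvgD => //; rewrite expr2; under eq_fun do rewrite expr2.
    have fgn : (fun g => hnorm (taylor f n - taylor g n)) @ F -->
        hnorm (taylor f n - a n).
      apply: cvg_hnorm; apply: cvgB; [exact: cvg_cst|exact: cn].
    exact: cvgM.
  rewrite -(cvg_lim _ fa) //; apply: limr_le; first exact: cvgP fa.
  apply: filterS FA => g Ag.
  have := hnorm_taylor_sum_le (f - g) n; rewrite taylorB => /le_trans; apply.
  by rewrite lerXn2r ?nnegrE ?hnorm_ge0 ?ltW //; exact: AA.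
have [g gE] : exists g : hardy Y, taylor g = a.
  have [A FA AA] := Fe 1 ltr01; have [f Af] := filter_ex FA.
  have sb : square_summable (fun k => taylor f k - a k).
    exact: square_summable_le (key _ _ ltr01 FA AA _ Af).
  have sa : square_summable a.
    have := square_summableD (taylor_summable f) (square_summableZ (-1) sb).
    rewrite (_ : (fun k => _ + _) = a) //.
    by apply/funext => k; rewrite scaleN1r opprB addrC subrK.
  have [h ah] := square_summable_power_series sa.
  have hP : h \in hardy_pred Y by apply/asboolP; exists a.
  by exists (Hardy hP); apply: taylorE.
apply/cvg_ex; exists g; apply/cvgrPdist_lt => e e0.
have eE : e = (complex.Re e)%:C by rewrite RRe_real // gtr0_real.
have re0 : 0 < complex.Re e by rewrite -ltcR -eE.
have e2 : 0 < complex.Re e / 2 by rewrite divr_gt0.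
have [A FA AA] := Fe _ e2.
apply: (filterS _ FA) => f Af; rewrite distrC -hnormE eE ltcR.
apply: (@le_lt_trans _ _ (complex.Re e / 2)); last by lra.
apply: hnorm_hardy_le => [|n]; first exact: ltW.
by rewrite taylorB gE; exact: key FA AA _ Af n.
Qed.

HB.instance Definition _ :=
  Uniform_isComplete.Build (hardy Y) hardy_complete.
HB.instance Definition _ :=
  NormedModule_isHilbert.Build R (hardy Y) hardy_dotxx_norm.
End HardyHilbert.

Definition separable_space (T : topologicalType) :=
  exists2 D : set T, countable D & dense D.

(* Below, objects characterized by a property that determines them uniquely
   are picked with xget; the default value only matters when none exists. *)
Section Operators.
Variables (R : realType) (H0 H : hilbertType R).

Definition bounded_operator (T : H0 -> H) :=
  linear T /\ exists M : R, forall x, hnorm (T x) <= M * hnorm x.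

Definition contractive_operator (T : H0 -> H) :=
  linear T /\ forall x, hnorm (T x) <= hnorm x.

Definition adjoint (T : H0 -> H) : H -> H0 :=
  xget (fun=> 0) [set A | forall x y, hdot (T x) y = hdot x (A y)].

Definition ker_op (T : H0 -> H) : set H0 := T @^-1` [set 0].

End Operators.

Section LiftedNorm.
Variables (R : realType).

Definition positive_operator (H : hilbertType R) (P : H -> H) :=
  bounded_operator P /\ forall x, 0 <= hdot (P x) x.

(* Defined by its characterization as the unique positive square root;
   meaningful for P a positive operator. *)
Definition sqrt_op (H : hilbertType R) (P : H -> H) : H -> H :=
  xget (fun=> 0) [set A | positive_operator A /\ forall x, A (A x) = P x].

Definition orth_compl (H : hilbertType R) (M : set H) : set H :=
  [set x | forall m, M m -> hdot x m = 0].

Definition orth_proj (H : hilbertType R) (M : set H) (x : H) : H :=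
  xget 0 [set p | M p /\ orth_compl M (x - p)].

(* A linear manifold of H with a norm of its own; nsnorm is meaningful
   only on nscarrier. *)
Record normed_submanifold (H : hilbertType R) := NormedSubmanifold {
  nscarrier : set H ;
  nsnorm : H -> R }.

Definition isometrically_equal (H : hilbertType R)
    (M N : normed_submanifold H) :=
  nscarrier M = nscarrier N /\
  forall f, nscarrier M f -> nsnorm M f = nsnorm N f.

(* Ran T normed by |T x| = |Q x|, with Q the orthogonal projection onto the
   orthogonal complement of K. The norm is computed on an arbitrary preimage,
   so K should contain Ker T. *)
Definition range_space (H0 H : hilbertType R) (T : H0 -> H) (K : set H0) :
    normed_submanifold H :=
  NormedSubmanifold (range T)
    (fun f => hnorm (orth_proj (orth_compl K) (xget 0 (T @^-1` [set f])))).

Definition lifted_norm_space (H : hilbertType R) (P : H -> H) :=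
  range_space (sqrt_op P) (ker_op P).

Definition pullback_space (H0 H : hilbertType R) (T : H0 -> H) :=
  range_space T (ker_op T).

(* The inner product of a Hilbert space M included in H, recovered from the
   norm by polarization. *)
Definition nsdot (H : hilbertType R) (M : normed_submanifold H) (x y : H) :
    R[i] :=
  4^-1 * \sum_(k < 4) 'i ^+ k * (nsnorm M (x + 'i ^+ k *: y) ^+ 2)%:C.

(* The adjoint of the inclusion of M into H; as its values lie in M, this is
   also the product of the inclusion with its adjoint. *)
Definition inclusion_adjoint (H : hilbertType R) (M : normed_submanifold H) :
    H -> H :=
  xget (fun=> 0) [set A | forall h, nscarrier M (A h) /\
    forall m, nscarrier M m -> hdot m h = nsdot M m (A h)].

Definition brangesian_complement (H : hilbertType R)
    (M : normed_submanifold H) :=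
  lifted_norm_space (fun h => h - inclusion_adjoint M h).

End LiftedNorm.

Section DeBrangesRovnyak.
Variables (R : realType) (U Y : hilbertType R).
Implicit Type S : unit_disk R -> U -> Y.

(* The power series of bounded operators converges in operator norm. *)
Definition analytic_operator_function S :=
  exists A : nat -> U -> Y, (forall k, bounded_operator (A k)) /\
    forall z (e : R), 0 < e -> \forall n \near \oo, forall u,
      hnorm (S z u - \sum_(0 <= k < n) val z ^+ k *: A k u) <= e * hnorm u.

Definition schur_class S :=
  analytic_operator_function S /\ forall z, contractive_operator (S z).

Definition toeplitz S (f : hardy U) : hardy Y :=
  xget 0 [set g : hardy Y | forall z, g z = S z (f z)].

Definition dBR_sqnorm S (f : hardy Y) : \bar R :=
  ereal_sup [set (hnorm (f + toeplitz S g) ^+ 2 - hnorm g ^+ 2)%:E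
            | g in [set: hardy U]].

Definition dBR_space S : normed_submanifold (hardy Y) :=
  NormedSubmanifold [set f | (dBR_sqnorm S f < +oo)%E]
    (fun f => Num.sqrt (fine (dBR_sqnorm S f))).

End DeBrangesRovnyak.

(* Main.v *)
(* For a contraction T and A = (1 - T T^* )^(1/2), the row [A T] is a coisometry,
   so |A x + T g|^2 - |g|^2 <= |x|^2; taking g = T^* y with A y close to x shows
   that |x|^2 is the supremum over g when x lies in the closure of the range of
   A. If the supremum at f is finite, then g = t T^* y gives
   |<f, y>| <= C |A y|, which forces f = A x for such an x.
   The complement of the pullback space is the same space because the adjoint
   of its inclusion is T T^*.
   That T_S is a contraction is seen on the circles |z| = r < 1: the mean of
   |p(z)|^2 over the K-th roots of unity times r is the sum of the
   r^(2k) |p_k|^2 for a polynomial p of degree less than K. *)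
Require Import Defs.
From mathcomp Require Import all_boot all_order all_algebra.
From mathcomp Require Import all_classical all_reals all_analysis.
From mathcomp Require Import complex.
From mathcomp Require Import cyclic separable cyclotomic.
From mathcomp Require Import ring lra.

Set Implicit Arguments.
Unset Strict Implicit.
Unset Printing Implicit Defensive.

Import Order.TTheory GRing.Theory Num.Theory.
Import numFieldNormedType.Exports.

Local Open Scope classical_set_scope.
Local Open Scope complex_scope.
Local Open Scope ring_scope.

(** * Real inner product and minimization *)

(** A single variational lemma, [energy_riesz], supplies the adjoint, the projection onto the
    complement of a kernel, and the vector x with A x = f. For the last, the functional y -> <y, f>
    is controlled by |A y| only, and x has to arise as a limit of vectors A u_n: this makes it
    orthogonal to Ker A, so that |x| is the lifted norm of f. The bound |<f, y>| <= C |A y| rests on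
    <f, y> = <f, T T^* y> + <A f, A y>. The second term is at most |f| |A y|; the first is the
    linear term of a quadratic in t, bounded above, whose leading coefficient is at least -|A y|^2.
    Most of the work is done with the real part of the inner product; complex statements follow by
    passing from x to i x. For T_S the obstacle is that S f must be known to lie in H^2 before T_S f
    means anything. The norm bound is therefore proved first for polynomial f, then for the formal
    coefficients of S f, and only afterwards are these identified with S f. *)

Lemma cvg_hnormP (R : realType) (V : normedModType R[i]) (u : nat -> V) (l : V) :
  u @ \oo --> l <-> (fun n => hnorm (u n - l)) @ \oo --> (0 : R).
Proof.
split=> [ul|/cvgrPdist_lt h].
  rewrite -(@hnorm_zero R V) -(subrr l).
  by apply: cvg_hnorm; apply: cvgB => //; exact: cvg_cst.
apply/cvgrPdist_lt => e e0.
have eE : e = (complex.Re e)%:C by rewrite RRe_real // gtr0_real.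
have /h : 0 < complex.Re e by rewrite -ltcR -eE.
apply: filterS => n; rewrite sub0r normrN ger0_norm ?hnorm_ge0 //.
by rewrite distrC -hnormE eE ltcR.
Qed.

Lemma cvg_ler (R : realType) (u v : nat -> R) (a b : R) :
  u @ \oo --> a -> v @ \oo --> b -> (forall n, u n <= v n) -> a <= b.
Proof.
move=> ua vb uv; rewrite -(cvg_lim _ ua) // -(cvg_lim _ vb) //.
by apply: ler_lim; [exact: cvgP ua|exact: cvgP vb|exact: nearW].
Qed.

Section RealDot.
Variables (R : realType) (H : hilbertType R).
Implicit Types (x y z : H) (t : R).

Definition rdot x y : R := complex.Re (hdot x y).

Lemma rdotDl x y z : rdot (x + y) z = rdot x z + rdot y z.
Proof. by rewrite /rdot linearDl raddfD. Qed.

Lemma rdotNl x z : rdot (- x) z = - rdot x z.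
Proof. by rewrite /rdot linearNl raddfN. Qed.

Lemma rdotBl x y z : rdot (x - y) z = rdot x z - rdot y z.
Proof. by rewrite rdotDl rdotNl. Qed.

Lemma rdotZl t x z : rdot (t%:C *: x) z = t * rdot x z.
Proof. by rewrite /rdot linearZl_LR /=; case: (hdot x z) => a b /=; ring. Qed.

Lemma hdotC x y : hdot x y = (hdot y x)^*%C.
Proof. by rewrite hermC expr0 mul1r. Qed.

Lemma rdotC x y : rdot x y = rdot y x.
Proof. by rewrite /rdot hdotC; case: (hdot y x). Qed.

Lemma rdotDr x y z : rdot z (x + y) = rdot z x + rdot z y.
Proof. by rewrite rdotC rdotDl !(rdotC z). Qed.

Lemma rdotNr x z : rdot z (- x) = - rdot z x.
Proof. by rewrite rdotC rdotNl rdotC. Qed.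

Lemma rdotBr x y z : rdot z (x - y) = rdot z x - rdot z y.
Proof. by rewrite rdotDr rdotNr. Qed.

Lemma rdotZr t x z : rdot z (t%:C *: x) = t * rdot z x.
Proof. by rewrite rdotC rdotZl rdotC. Qed.

Lemma rdotxx x : rdot x x = hnorm x ^+ 2.
Proof. by rewrite /rdot hdotxx_hnorm. Qed.

Lemma rdot0l x : rdot 0 x = 0.
Proof. by rewrite /rdot linear0l. Qed.

Lemma hnorm0_eq0 x : hnorm x = 0 -> x = 0.
Proof. by move=> x0; apply/normr0_eq0; rewrite -hnormE x0. Qed.

Lemma rdotxx_eq0 x : rdot x x = 0 -> x = 0.
Proof. by rewrite rdotxx => /eqP; rewrite sqrf_eq0 => /eqP/hnorm0_eq0. Qed.

Lemma hnorm_realZ_abs t x : hnorm (t%:C *: x) = `|t| * hnorm x.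
Proof. by rewrite hnormZ normc_def /= expr0n addr0 sqrtr_sqr. Qed.

(** The imaginary part is minus the real part at i x, so an identity between real inner products
    that holds at x and at i x is an identity between complex ones. *)
Lemma Im_hdot x y : complex.Im (hdot x y) = - rdot ('i *: x) y.
Proof.
rewrite /rdot linearZl_LR /= -complexiE.
by case: (hdot x y) => a b /=; ring.
Qed.

Lemma rdot_CauchySchwarz x y : `|rdot x y| <= hnorm x * hnorm y.
Proof.
rewrite -(@ler_pXn2r _ 2) ?nnegrE ?mulr_ge0 ?hnorm_ge0 // real_normK ?num_real //.
have := dot_CauchySchwarz hdot x y.
rewrite !hdotxx_hnorm -rmorphM /= -add_Re2_Im2 lecR exprMn.
by apply: le_trans; rewrite lerDl sqr_ge0.
Qed.

Lemma sqr_hnormDr x y :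
  hnorm (x + y) ^+ 2 = hnorm x ^+ 2 + 2 * rdot x y + hnorm y ^+ 2.
Proof. by rewrite -!rdotxx rdotDl !rdotDr (rdotC y x); ring. Qed.

Lemma sqr_hnormBr x y :
  hnorm (x - y) ^+ 2 = hnorm x ^+ 2 - 2 * rdot x y + hnorm y ^+ 2.
Proof. by rewrite sqr_hnormDr rdotNr hnorm_opp mulrN. Qed.

Lemma hnormBC x y : hnorm (x - y) = hnorm (y - x).
Proof. by rewrite -hnorm_opp opprB. Qed.

Lemma rdot_ext x y : (forall z, rdot z x = rdot z y) -> x = y.
Proof.
move=> xy; apply/eqP; rewrite -subr_eq0; apply/eqP/rdotxx_eq0.
by rewrite rdotBr xy subrr.
Qed.

Lemma cvg_rdotl (u : nat -> H) x y :
  u @ \oo --> x -> (fun n => rdot (u n) y) @ \oo --> rdot x y.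
Proof.
move=> ux.
have h0 : (fun n => hnorm (u n - x) * hnorm y) @ \oo --> (0 : R).
  rewrite -(mul0r (hnorm y)); apply: cvgM; last exact: cvg_cst.
  exact/cvg_hnormP.
apply/cvgrPdist_le => e e0; move/cvgrPdist_le : h0 => /(_ e e0).
apply: filterS => n; rewrite sub0r normrN => he.
rewrite -rdotBl; apply: le_trans (rdot_CauchySchwarz _ _) _.
by rewrite hnormBC; apply: le_trans he; exact: ler_norm.
Qed.

Lemma cvg_rdotr (u : nat -> H) x y :
  u @ \oo --> x -> (fun n => rdot y (u n)) @ \oo --> rdot y x.
Proof.
by move=> ux; rewrite rdotC; under eq_fun do rewrite rdotC; exact: cvg_rdotl.
Qed.

Lemma hnorm_cauchy_cvg (u : nat -> H) :
  (forall e : R, 0 < e -> \forall n \near \oo, forall m, (n <= m)%N ->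
     hnorm (u m - u n) <= e) -> cvgn u.
Proof.
move=> uC; apply/cauchy_cvgP/cauchy_ballP => e e0.
have eE : e = (complex.Re e)%:C by rewrite RRe_real // gtr0_real.
have re0 : 0 < complex.Re e by rewrite -ltcR -eE.
have e3 : 0 < complex.Re e / 3 by rewrite divr_gt0.
have [N _ hN] := uC _ e3.
have AN : (u @ \oo) (u @` [set n | (N <= n)%N]).
  by exists N => // n Nn; exists n.
exists (u @` [set n | (N <= n)%N], u @` [set n | (N <= n)%N]) => //=.
move=> [_ _] [/= [n Nn <-] [m Nm <-]].
rewrite -ball_normE /= -hnormE eE ltcR.
have h1 := hN N (leqnn N) n Nn; have h2 := hN N (leqnn N) m Nm.
have := ler_hnormD (u n - u N) (u N - u m).
rewrite addrA subrK (hnormBC (u N)); lra.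
Qed.

End RealDot.
Arguments cvg_rdotl {R H u x} y _.
Arguments cvg_rdotr {R H u x} y _.

Lemma hdot_eq (R : realType) (H H' : hilbertType R) (x y : H) (x' y' : H') :
  rdot x y = rdot x' y' -> rdot ('i *: x) y = rdot ('i *: x') y' ->
  hdot x y = hdot x' y'.
Proof.
move=> e1 e2; apply/eqP; rewrite eq_complex !Im_hdot e2 eqxx andbT; exact/eqP.
Qed.

Section BoundedOperator.
Variables (R : realType) (H0 H : hilbertType R) (T : H0 -> H).
Hypothesis bT : bounded_operator T.

Lemma bounded_operatorD x y : T (x + y) = T x + T y.
Proof. by have := bT.1 1 x y; rewrite !scale1r. Qed.

Lemma bounded_operator0 : T 0 = 0.
Proof. by apply: (addrI (T 0)); rewrite -bounded_operatorD !addr0. Qed.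

Lemma bounded_operatorZ c x : T (c *: x) = c *: T x.
Proof. by rewrite -[c *: x]addr0 bT.1 bounded_operator0 addr0. Qed.

Lemma bounded_operatorN x : T (- x) = - T x.
Proof. by rewrite -scaleN1r bounded_operatorZ scaleN1r. Qed.

Lemma bounded_operatorB x y : T (x - y) = T x - T y.
Proof. by rewrite bounded_operatorD bounded_operatorN. Qed.

Lemma bounded_operator_cvg (u : nat -> H0) x :
  u @ \oo --> x -> (fun n => T (u n)) @ \oo --> T x.
Proof.
have [M TM] := bT.2 => /cvg_hnormP ux; apply/cvg_hnormP.
have h0 : (fun n => M * hnorm (u n - x)) @ \oo --> (0 : R).
  by rewrite -(mulr0 M); apply: cvgM; [exact: cvg_cst|].
apply: (squeeze_cvgr _ (cvg_cst 0) h0).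
by apply: nearW => n; rewrite hnorm_ge0 -bounded_operatorB TM.
Qed.

End BoundedOperator.

Lemma contractive_bounded (R : realType) (H0 H : hilbertType R) (T : H0 -> H) :
  contractive_operator T -> bounded_operator T.
Proof. by move=> [lT cT]; split => //; exists 1 => x; rewrite mul1r. Qed.

(* Minimizing |L v|^2 - 2 psi v over D: by the parallelogram identity the
   images under L of a minimizing sequence form a Cauchy sequence. *)
Lemma energy_riesz (R : realType) (V : lmodType R[i]) (H : hilbertType R)
    (D : set V) (L : V -> H) (psi : V -> R) (C : R) :
  D 0 -> (forall (t : R) v w, D v -> D w -> D (v + t%:C *: w)) ->
  (forall (t : R) v w, L (v + t%:C *: w) = L v + t%:C *: L w) ->
  (forall (t : R) v w, psi (v + t%:C *: w) = psi v + t * psi w) ->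
  (forall v, D v -> `|psi v| <= C * hnorm (L v)) ->
  exists x : H,
    (exists2 u : nat -> V, (forall n, D (u n)) & (L \o u) @ \oo --> x) /\
    (forall v, D v -> rdot (L v) x = psi v).
Proof.
move=> D0 DD LD psiD psiC.
pose J v := hnorm (L v) ^+ 2 - 2 * psi v.
pose E := [set J v | v in D].
(* Completing the square: J v >= |L v|^2 - 2 C |L v| >= -C^2. *)
have JC v : D v -> - C ^+ 2 <= J v.
  move=> Dv; have := psiC _ Dv; rewrite /J ler_norml => /andP[_].
  by have := sqr_ge0 (hnorm (L v) - C); lra.
have iE : has_inf E.
  by split; [exists (J 0), 0|exists (- C ^+ 2) => _ [v Dv <-]; exact: JC].
pose m := inf E.
have Jm v : D v -> m <= J v by move=> Dv; apply: ge_inf; [exact: iE.2|exists v].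
have [u uP] : exists u : nat -> V, forall n, D (u n) /\ J (u n) < m + n.+1%:R^-1.
  have hE n : exists v, D v /\ J v < m + n.+1%:R^-1.
    have [] := @inf_adherent _ E n.+1%:R^-1 _ iE; first by rewrite invr_gt0.
    by move=> _ [v Dv <-] Jv; exists v.
  by have [u uP] := choice hE; exists u.
have par v w : D v -> D w ->
    hnorm (L v - L w) ^+ 2 <= 2 * (J v - m) + 2 * (J w - m).
  move=> Dv Dw; pose z := 0 + (2^-1)%:C *: (v + 1%:C *: w).
  have Dz : D z by apply: (DD _ _ _ D0); exact: DD.
  have := Jm _ Dz; rewrite /J /z.
  have psi0 : psi 0 = 0.
    by have := psiD (-1) 0 0; rewrite scaler0 addr0; lra.
  have L0 : L 0 = 0.
    have := LD (-1) 0 0; rewrite scaler0 addr0 rmorphN1 scaleN1r subrr.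
    by [].
  rewrite !LD !psiD L0 psi0 add0r scale1r.
  by rewrite -!rdotxx rdotZl rdotZr !rdotDl !rdotDr !rdotNl !rdotNr (rdotC (L w)); lra.
have cu : cvgn (L \o u).
  apply: hnorm_cauchy_cvg => e e0.
  have e2 : 0 < e ^+ 2 / 4 by rewrite divr_gt0 // exprn_gt0.
  have := near_infty_natSinv_lt (PosNum e2).
  apply: filterS => n /= hn k nk.
  rewrite -(@ler_pXn2r _ 2) ?nnegrE ?hnorm_ge0 ?(ltW e0) //.
  apply: le_trans (par _ _ (uP _).1 (uP _).1) _.
  have := (uP k).2; have := (uP n).2.
  have : k.+1%:R^-1 <= n.+1%:R^-1 :> R by rewrite lef_pV2 ?posrE // ler_nat.
  have : n.+1%:R^-1 < e ^+ 2 / 4 := hn.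
  by move: (n.+1%:R^-1) (k.+1%:R^-1) (J _) (J _) (e ^+ 2) => a b c d f; lra.
move/cvg_ex : cu => [x ux]; exists x; split; first by exists u => // n; exact: (uP n).1.
move=> v Dv.
(* The minimizing sequence is compared with its translates by t v. An inequality valid for all real
   t forces the linear coefficient to vanish. *)
have key (t : R) : 0 <= t ^+ 2 * hnorm (L v) ^+ 2 + 2 * t * (rdot (L v) x - psi v).
  have lhs n : - n.+1%:R^-1 <= t ^+ 2 * hnorm (L v) ^+ 2 +
      2 * t * (rdot (L v) (L (u n)) - psi v).
    have := Jm _ (DD t _ _ (uP n).1 Dv); have := (uP n).2.
    rewrite /J LD psiD sqr_hnormDr rdotZr hnorm_realZ_abs exprMn real_normK ?num_real //.
    rewrite (rdotC (L (u n))).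
    move: (n.+1%:R^-1) (rdot _ _) (hnorm (L v)) => e d a. lra.
  have c1 : (fun n => - n.+1%:R^-1 : R) @ \oo --> (0 : R).
    by rewrite -oppr0; apply: cvgN; exact: cvg_harmonic.
  have c2 : (fun n => t ^+ 2 * hnorm (L v) ^+ 2 +
      2 * t * (rdot (L v) (L (u n)) - psi v)) @ \oo -->
      t ^+ 2 * hnorm (L v) ^+ 2 + 2 * t * (rdot (L v) x - psi v).
    apply: cvgD; first exact: cvg_cst.
    apply: cvgM; first exact: cvg_cst.
    by apply: cvgB; [exact: cvg_rdotr|exact: cvg_cst].
  by apply: (cvg_ler c1 c2).
set d := rdot (L v) x - psi v in key; set a := hnorm (L v) ^+ 2 in key.
have a0 : 0 <= a by rewrite sqr_ge0.
(* The quadratic is smallest at -d / a; 1 + a in place of a keeps the quotient defined when L v = 0,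
   and the value is still negative unless d = 0. *)
have := key (- d / (1 + a)).
have a1 : 1 + a != 0 by rewrite gt_eqF //; lra.
have -> : (- d / (1 + a)) ^+ 2 * a + 2 * (- d / (1 + a)) * d =
   - (d ^+ 2 * ((2 + a) / (1 + a) ^+ 2)) by field.
rewrite oppr_ge0 pmulr_lle0; last by rewrite divr_gt0 ?exprn_gt0 //; lra.
move=> d2; apply/eqP; rewrite -subr_eq0 -sqrf_eq0; apply/eqP/le_anti.
by rewrite d2 sqr_ge0.
Qed.

(** * Adjoints of bounded operators *)

Section Adjoint.
Variables (R : realType) (H0 H : hilbertType R) (T : H0 -> H).

Lemma adjointP : bounded_operator T ->
  forall x y, hdot (T x) y = hdot x (adjoint T y).
Proof.
move=> bT; suff /choice[A AP] : forall y, exists a, forall x, hdot (T x) y = hdot x a.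
  exact: (xgetPex (fun=> 0) (ex_intro
    [set A | forall x y, hdot (T x) y = hdot x (A y)] A (fun x y => AP y x))).
move=> y; have [M TM] := bT.2.
(* With [L] the identity on the whole space, this is the Riesz representation of v -> Re <T v,
   y>. *)
have [|t v w|t v w|t v w|v _|a [_ aP]] := @energy_riesz R H0 H0 setT id
  (fun v => rdot (T v) y) (M * hnorm y) => //.
- by rewrite bounded_operatorD // bounded_operatorZ // rdotDl rdotZl.
- apply: le_trans (rdot_CauchySchwarz _ _) _.
  by rewrite mulrAC ler_wpM2r // hnorm_ge0.
exists a => x; apply: hdot_eq; first by rewrite (aP x).
by rewrite -bounded_operatorZ // (aP ('i *: x)).
Qed.

Lemma rdot_adjoint : bounded_operator T ->
  forall x y, rdot (T x) y = rdot x (adjoint T y).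
Proof. by move=> bT x y; rewrite /rdot adjointP. Qed.

(** Cauchy-Schwarz on |T^* y|^2 = Re <T T^* y, y> gives |T^* y|^2 <= |T^* y| |y|. *)
Lemma adjoint_contractive :
  contractive_operator T -> contractive_operator (adjoint T).
Proof.
move=> cT; have bT := contractive_bounded cT; split=> [c y y'|y].
  apply: rdot_ext => z; rewrite /rdot linearDr /= linearZr_LR /= -!adjointP //.
  by rewrite linearDr /= linearZr_LR.
have := rdot_CauchySchwarz (T (adjoint T y)) y.
rewrite rdot_adjoint // rdotxx ler_norml => /andP[_].
have := cT.2 (adjoint T y); have := hnorm_ge0 (adjoint T y); have := hnorm_ge0 y.
move: (hnorm (T _)) (hnorm (adjoint _ _)) (hnorm y) => a b c c0 b0 ab h.
by have [//|cb] := leP b c; nra.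
Qed.

End Adjoint.

(** The factorization F^2 - G^2 = (F - G)(F + G), which turns one increment of the square root
    iteration into the next. *)
Lemma commuting_sqrB (R : realType) (H : hilbertType R) (F G : H -> H) :
  bounded_operator F -> bounded_operator G -> (forall x, G (F x) = F (G x)) ->
  forall x, F (F x) - G (G x) = F (F x + G x) - G (F x + G x).
Proof.
move=> bF bG FG x; rewrite (bounded_operatorD bF) (bounded_operatorD bG) FG.
by rewrite opprD addrA addrK.
Qed.

(** * Square roots of positive operators *)

Section SquareRoot.
Variables (R : realType) (H : hilbertType R) (B : H -> H).

(* [F] is [p(B)] and [a] is [p(1)], for [p] a polynomial with nonnegative
   coefficients and no constant term. *)
Inductive nonneg_poly_op : (H -> H) -> R -> Prop :=
| NPOzero : nonneg_poly_op (fun=> 0) 0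
| NPObase : nonneg_poly_op B 1
| NPOadd F G a b : nonneg_poly_op F a -> nonneg_poly_op G b ->
    nonneg_poly_op (fun x => F x + G x) (a + b)
| NPOcomp F G a b : nonneg_poly_op F a -> nonneg_poly_op G b ->
    nonneg_poly_op (fun x => F (G x)) (a * b)
| NPOscale t F a : 0 <= t -> nonneg_poly_op F a ->
    nonneg_poly_op (fun x => t%:C *: F x) (t * a).

Hypothesis cB : contractive_operator B.
Hypothesis sB : forall x y, rdot (B x) y = rdot x (B y).

(** For a contraction B and nonnegative coefficients, |p(B)| <= p(1). Norm estimates for the
    iteration thereby reduce to a scalar sequence. *)
Lemma nonneg_poly_op_bound F a : nonneg_poly_op F a ->
  0 <= a /\ forall x, hnorm (F x) <= a * hnorm x.
Proof.
elim=> {F a} [||F G a b _ [a0 Fa] _ [b0 Gb]|F G a b _ [a0 Fa] _ [b0 Gb]|t F a t0 _ [a0 Fa]].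
- by split=> // x; rewrite hnorm_zero mul0r.
- by split=> // x; rewrite mul1r; exact: cB.2.
- split=> [|x]; first exact: addr_ge0.
  by rewrite mulrDl; apply: le_trans (ler_hnormD _ _) _; rewrite lerD.
- split=> [|x]; first exact: mulr_ge0.
  by apply: le_trans (Fa _) _; rewrite -mulrA ler_wpM2l.
- split=> [|x]; first exact: mulr_ge0.
  by rewrite hnorm_realZ_abs ger0_norm // -mulrA ler_wpM2l.
Qed.

Lemma nonneg_poly_op_linear F a : nonneg_poly_op F a -> linear F.
Proof.
elim=> {F a} [||F G a b _ lF _ lG|F G a b _ lF _ lG|t F a t0 _ lF] c x y.
- by rewrite scaler0 addr0.
- exact: cB.1.
- by rewrite lF lG scalerDr addrACA.
- by rewrite lG lF.
- by rewrite lF scalerDr !scalerA mulrC.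
Qed.

Lemma nonneg_poly_op_bounded F a : nonneg_poly_op F a -> bounded_operator F.
Proof.
move=> Fa; split; first exact: nonneg_poly_op_linear Fa.
by exists a; exact: (nonneg_poly_op_bound Fa).2.
Qed.

Lemma nonneg_poly_op_comm F G a b : nonneg_poly_op F a -> nonneg_poly_op G b ->
  forall x, F (G x) = G (F x).
Proof.
have bB := contractive_bounded cB.
move=> Fa; have bF := nonneg_poly_op_bounded Fa.
have FB x : F (B x) = B (F x).
  elim: Fa x => {bF F a} [||F F' a a' _ hF _ hF'|F F' a a' _ hF _ hF'|t F a t0 _ hF] x.
  - by rewrite bounded_operator0.
  - by [].
  - by rewrite hF hF' bounded_operatorD.
  - by rewrite hF' hF.
  - by rewrite hF bounded_operatorZ.
elim=> {G b} [||G G' b b' _ hG _ hG'|G G' b b' _ hG _ hG'|t G b t0 _ hG] x.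
- by rewrite bounded_operator0.
- exact: FB.
- by rewrite bounded_operatorD // hG hG'.
- by rewrite hG hG'.
- by rewrite bounded_operatorZ // hG.
Qed.

Lemma nonneg_poly_op_sym F a : nonneg_poly_op F a ->
  forall x y, rdot (F x) y = rdot x (F y).
Proof.
elim=> {F a} [||F G a b _ hF _ hG|F G a b Fa hF Gb hG|t F a t0 _ hF] x y.
- by rewrite rdot0l rdotC rdot0l.
- exact: sB.
- by rewrite rdotDl hF hG rdotDr.
- by rewrite hF hG; congr rdot; rewrite (nonneg_poly_op_comm Gb Fa).
- by rewrite rdotZl hF rdotZr.
Qed.

(* The increasing iteration [Y := (B + Y ^ 2) / 2], whose limit [Y] satisfies
   [(1 - Y) ^ 2 = 1 - B]. *)
Fixpoint sqrt_iter n : H -> H :=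
  if n is n'.+1 then
    fun x => (2^-1)%:C *: (B x + sqrt_iter n' (sqrt_iter n' x))
  else fun=> 0.

(** The same recursion with [B] replaced by 1: the value at 1 of the polynomial behind
    [sqrt_iter n]. *)
Fixpoint sqrt_iter_bound n : R :=
  if n is n'.+1 then 2^-1 * (1 + sqrt_iter_bound n' * sqrt_iter_bound n') else 0.

Lemma sqrt_iter_npo n : nonneg_poly_op (sqrt_iter n) (sqrt_iter_bound n).
Proof.
elim: n => [|n IHn] /=; first exact: NPOzero.
by apply: NPOscale => //; apply: NPOadd; [exact: NPObase|exact: NPOcomp].
Qed.

(** Consecutive increments satisfy D' = (1/2) D (Y' + Y), where Y and Y' are the iterates whose
    difference is D. By induction they are again polynomials in B with nonnegative coefficients,
    hence dominated by the increments of the scalar sequence, which increases and stays below 1. *)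
Lemma sqrt_iter_step n :
  nonneg_poly_op (fun x => sqrt_iter n.+1 x - sqrt_iter n x)
    (sqrt_iter_bound n.+1 - sqrt_iter_bound n).
Proof.
elim: n => [|n IHn].
  rewrite [X in nonneg_poly_op X](_ : _ = fun x => (2^-1)%:C *: B x).
    rewrite [X in nonneg_poly_op _ X](_ : _ = 2^-1 * 1) /=; last by ring.
    by apply: NPOscale => //; exact: NPObase.
  by apply/funext => x /=; rewrite subr0 addr0.
have [h1 h0] := (sqrt_iter_npo n.+1, sqrt_iter_npo n).
have [b1 b0] := (nonneg_poly_op_bounded h1, nonneg_poly_op_bounded h0).
have c01 := nonneg_poly_op_comm h0 h1.
have E1 x : sqrt_iter n.+2 x =
    (2^-1)%:C *: (B x + sqrt_iter n.+1 (sqrt_iter n.+1 x)) by [].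
have E0 x : sqrt_iter n.+1 x =
    (2^-1)%:C *: (B x + sqrt_iter n (sqrt_iter n x)) by [].
have e1 : sqrt_iter_bound n.+2 =
    2^-1 * (1 + sqrt_iter_bound n.+1 * sqrt_iter_bound n.+1) by [].
have e0 : sqrt_iter_bound n.+1 =
    2^-1 * (1 + sqrt_iter_bound n * sqrt_iter_bound n) by [].
rewrite [X in nonneg_poly_op X](_ : _ = fun x => (2^-1)%:C *:
  (sqrt_iter n.+1 (sqrt_iter n.+1 x + sqrt_iter n x) -
   sqrt_iter n (sqrt_iter n.+1 x + sqrt_iter n x))); last first.
  apply/funext => x; rewrite E1 [X in _ - X = _]E0 -scalerBr opprD addrACA.
  rewrite subrr add0r; congr (_ *: _).
  exact: (commuting_sqrB b1 b0 c01).
rewrite e1 [X in _ - X]e0.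
rewrite (_ : _ - _ = 2^-1 * ((sqrt_iter_bound n.+1 - sqrt_iter_bound n) *
   (sqrt_iter_bound n.+1 + sqrt_iter_bound n))); last by ring.
apply: NPOscale => //.
exact: (NPOcomp IHn (NPOadd h1 h0)).
Qed.

Lemma sqrt_iter_diff n k :
  nonneg_poly_op (fun x => sqrt_iter (n + k) x - sqrt_iter n x)
    (sqrt_iter_bound (n + k) - sqrt_iter_bound n).
Proof.
elim: k => [|k IHk].
  rewrite addn0 subrr [X in nonneg_poly_op X](_ : _ = fun=> 0); first exact: NPOzero.
  by apply/funext => x; rewrite subrr.
rewrite addnS; have := NPOadd (sqrt_iter_step (n + k)) IHk.
rewrite subrKA; congr nonneg_poly_op.
by apply/funext => x; rewrite subrKA.
Qed.

Lemma sqrt_iter_bound_le1 n : sqrt_iter_bound n <= 1.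
Proof.
elim: n => [|n IHn] /=; first exact: ler01.
by have := (nonneg_poly_op_bound (sqrt_iter_npo n)).1; nra.
Qed.

Lemma cvg_sqrt_iter x : cvgn (sqrt_iter ^~ x).
Proof.
have cr : cvgn sqrt_iter_bound.
  apply: nondecreasing_is_cvgn.
    apply/nondecreasing_seqP => n; rewrite -subr_ge0.
    exact: (nonneg_poly_op_bound (sqrt_iter_step n)).1.
  by exists 1 => _ [n _ <-]; exact: sqrt_iter_bound_le1.
apply: hnorm_cauchy_cvg => e e0.
have x1 : 0 < hnorm x + 1 by rewrite ltr_wpDl // hnorm_ge0.
have /cvgrPdist_lt /(_ (e / (hnorm x + 1))) [] := cr; first by rewrite divr_gt0.
move=> N _ hN; exists N => // n Nn m nm.
have := (nonneg_poly_op_bound (sqrt_iter_diff n (m - n))).2 x.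
rewrite subnKC // => /le_trans; apply.
have := hN n Nn; rewrite ltr_norml => /andP[_].
have : sqrt_iter_bound m <= limn sqrt_iter_bound.
  apply: nondecreasing_cvgn_le => //; apply/nondecreasing_seqP => k.
  by rewrite -subr_ge0; exact: (nonneg_poly_op_bound (sqrt_iter_step k)).1.
rewrite ltr_pdivlMr // => h1 h2; have := hnorm_ge0 x; nra.
Qed.

End SquareRoot.

Section PositiveOperators.
Variables (R : realType) (H : hilbertType R).
Implicit Types (A B : H -> H) (x y : H).

Lemma rdotii x y : rdot ('i *: x) ('i *: y) = rdot x y.
Proof.
rewrite /rdot linearZl_LR /= linearZr_LR /= mulrA.
by rewrite -normCK normCi expr1n mul1r.
Qed.

(** Nonnegativity in [R[i]] includes that <A x, x> is real: symmetry at i x and x makes its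
    imaginary part equal to its own opposite. *)
Lemma positive_operator_of_sym A : bounded_operator A ->
  (forall x y, rdot (A x) y = rdot x (A y)) -> (forall x, 0 <= rdot (A x) x) ->
  positive_operator A.
Proof.
move=> bA sA pA; split=> // x.
have e : complex.Im (hdot (A x) x) = 0.
  have h1 := Im_hdot (A x) x; have h2 := Im_hdot x (A x).
  have h3 : complex.Im (hdot x (A x)) = - complex.Im (hdot (A x) x).
    by rewrite hdotC; case: (hdot _ _).
  rewrite -(bounded_operatorZ bA) sA in h1.
  by lra.
by rewrite lecE e eqxx /=; exact: pA.
Qed.

(** As <A z, z> is real, Re <i A z, z> vanishes; polarizing at x + y and then replacing x by i x
    gives the symmetry. *)
Lemma positive_operator_sym A : positive_operator A ->
  forall x y, rdot (A x) y = rdot x (A y).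
Proof.
move=> [bA pA].
have i0 z : rdot ('i *: A z) z = 0.
  have := Im_hdot (A z) z; have := pA z; rewrite lecE => /andP[/eqP -> _] /=.
  by lra.
have pol x y : rdot ('i *: A x) y + rdot ('i *: A y) x = 0.
  have := i0 (x + y).
  by rewrite (bounded_operatorD bA) scalerDr rdotDl !rdotDr !i0; lra.
move=> x y; have := pol ('i *: x) y.
rewrite (bounded_operatorZ bA) scalerA -expr2 sqrCi scaleN1r rdotNl rdotii.
by rewrite (rdotC (A y)); lra.
Qed.

Lemma sqrt_op_exists B : contractive_operator B ->
  (forall x y, rdot (B x) y = rdot x (B y)) ->
  exists A, positive_operator A /\ forall x, A (A x) = x - B x.
Proof.
move=> cB sB; pose Q := sqrt_iter B.
have npo n : nonneg_poly_op B (Q n) (sqrt_iter_bound R n) := sqrt_iter_npo B n.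
have bQ n : bounded_operator (Q n) := nonneg_poly_op_bounded cB (npo n).
have hQ n x : hnorm (Q n x) <= hnorm x.
  apply: le_trans ((nonneg_poly_op_bound cB (npo n)).2 x) _.
  by rewrite ler_piMl ?hnorm_ge0 // (sqrt_iter_bound_le1 cB).
pose Y x := limn (Q ^~ x).
have QY x : Q ^~ x @ \oo --> Y x by exact: cvg_sqrt_iter.
have cY : contractive_operator Y.
  split=> [c x y|x].
    have h : (fun n => Q n (c *: x + y)) @ \oo --> c *: Y x + Y y.
      under eq_fun do rewrite (bQ _).1.
      by apply: cvgD; [apply: cvgZr; exact: QY|exact: QY].
    exact: (cvg_unique (@norm_hausdorff _ _) (QY _) h).
  apply: (cvg_ler (cvg_hnorm _ (QY x)) (cvg_cst (hnorm x))) => n; exact: hQ.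
have sY x y : rdot (Y x) y = rdot x (Y y).
  have h1 := cvg_rdotl y (QY x); have h2 := cvg_rdotr x (QY y).
  apply: (cvg_unique (@norm_hausdorff _ _) h1); rewrite (_ : (fun n => _) = fun n => rdot x (Q n y)) //.
  by apply/funext => n; exact: (nonneg_poly_op_sym cB sB (npo n)).
(* Pointwise convergence passes to the composite because the Q n are uniformly contractive: the
   argument Q n x may be replaced by its limit Y x. *)
have QQ x : (fun n => Q n (Q n x)) @ \oo --> Y (Y x).
  apply/cvg_hnormP.
  have h : (fun n => hnorm (Q n x - Y x) + hnorm (Q n (Y x) - Y (Y x))) @ \oo --> (0 : R).
    by rewrite -(addr0 0); apply: cvgD; apply/cvg_hnormP; exact: QY.
  apply: (squeeze_cvgr _ (cvg_cst 0) h); apply: nearW => n; rewrite hnorm_ge0 /=.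
  have -> : Q n (Q n x) - Y (Y x) = Q n (Q n x - Y x) + (Q n (Y x) - Y (Y x)).
    by rewrite (bounded_operatorB (bQ n)) subrKA.
  by apply: le_trans (ler_hnormD _ _) _; rewrite lerD2r hQ.
have YY x : B x + Y (Y x) = 2%:C *: Y x.
  have h1 : (fun n => (2%:C : R[i]) *: Q n.+1 x) @ \oo --> 2%:C *: Y x.
    by apply: cvgZr; rewrite (cvg_shiftS (fun n => Q n x)); exact: QY.
  have h2 : (fun n => B x + Q n (Q n x)) @ \oo --> B x + Y (Y x).
    by apply: cvgD; [exact: cvg_cst|exact: QQ].
  apply: (cvg_unique (@norm_hausdorff _ _) h2); rewrite (_ : (fun n => _) = fun n => 2%:C *: Q n.+1 x) //.
  apply/funext => n /=; rewrite scalerA -rmorphM /= mulfV // ?pnatr_eq0 //.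
  by rewrite scale1r.
have bY := contractive_bounded cY.
exists (fun x => x - Y x); split; last first.
  move=> x; rewrite (bounded_operatorB bY) -(addrK (Y (Y x)) (B x)) YY.
  rewrite (_ : 2%:C *: Y x = Y x + Y x); first by rewrite !opprD !opprK !addrA.
  by rewrite (_ : 2%:C = 1 + 1) ?scalerDl ?scale1r // rmorphD.
apply: positive_operator_of_sym.
- split=> [c x y|]; first by rewrite bY.1 scalerBr opprD addrACA.
  exists 2 => x; have := ler_hnormD x (- Y x); rewrite hnorm_opp.
  by have := cY.2 x; lra.
- by move=> x y; rewrite rdotBl rdotBr sY.
- move=> x; rewrite rdotBl rdotxx.
  have := rdot_CauchySchwarz (Y x) x; rewrite ler_norml => /andP[_].
  have := cY.2 x; have := hnorm_ge0 x; nra.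
Qed.

Lemma sqrt_opP B : contractive_operator B ->
  (forall x y, rdot (B x) y = rdot x (B y)) ->
  positive_operator (sqrt_op (fun x => x - B x)) /\
  forall x, sqrt_op (fun x => x - B x) (sqrt_op (fun x => x - B x) x) = x - B x.
Proof.
move=> cB sB; have [A AP] := sqrt_op_exists cB sB.
exact: (xgetPex (fun=> 0) (ex_intro [set A | positive_operator A /\
  forall x, A (A x) = x - B x] A AP)).
Qed.

End PositiveOperators.

(** * Orthogonal complements and projections *)

Section OrthProj.
Variables (R : realType) (H : hilbertType R).
Implicit Types (M : set H) (x y p : H).

(** The imaginary part of <x, m> is a real inner product of x with a multiple of m, so closure under
    complex scalars reduces orthogonality to real parts. *)
Lemma orth_complP M : (forall c m, M m -> M (c *: m)) ->
  forall x, orth_compl M x <-> forall m, M m -> rdot x m = 0.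
Proof.
move=> MZ x; split=> [Mx m /Mx|Mx m Mm]; first by rewrite /rdot => ->.
suff -> : hdot x m = hdot (0 : H) m by rewrite linear0l.
apply: hdot_eq.
  by rewrite rdot0l Mx.
rewrite scaler0 rdot0l -rdotii scalerA -expr2 sqrCi scaleN1r rdotNl.
by rewrite Mx ?oppr0 //; exact: MZ.
Qed.

Lemma orth_complZ M c x : orth_compl M x -> orth_compl M (c *: x).
Proof. by move=> Mx m Mm; rewrite linearZl_LR /= Mx // mulr0. Qed.

Lemma orth_complD M x y : orth_compl M x -> orth_compl M y -> orth_compl M (x + y).
Proof. by move=> Mx My m Mm; rewrite linearDl /= Mx // My // addr0. Qed.

Lemma orth_complB M x y : orth_compl M x -> orth_compl M y -> orth_compl M (x - y).
Proof. by move=> Mx My; rewrite -scaleN1r; apply/orth_complD/orth_complZ. Qed.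

(** M lies in its double complement, so p qualifies. Any other candidate q has q - p in the
    complement of M, to which both x - p and x - q are orthogonal. *)
Lemma orth_proj_complE M x p :
  orth_compl M p -> M (x - p) -> orth_proj (orth_compl M) x = p.
Proof.
move=> Mp Mxp; apply: xget_unique; first split=> //.
  by move=> m Mm; rewrite hdotC Mm // conjc0.
move=> q [Mq Mxq]; apply/eqP; rewrite -subr_eq0; apply/eqP/rdotxx_eq0.
have Mqp : orth_compl M (q - p) by exact: orth_complB.
have e1 : rdot (x - q) (q - p) = 0 by rewrite /rdot Mxq.
have e2 : rdot (q - p) (x - p) = 0 by rewrite /rdot Mqp.
have -> : rdot (q - p) (q - p) = rdot (q - p) (x - p) - rdot (x - q) (q - p).
  by rewrite (rdotC (x - q)) -rdotBr; congr rdot; rewrite opprB [RHS]addrC addrA subrK.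
by rewrite e1 e2 subr0.
Qed.

End OrthProj.

(** * Complement of the range of a contraction *)

Section Complement.
Variables (R : realType) (H0 H : hilbertType R) (T : H0 -> H).
Hypothesis cT : contractive_operator T.
Let bT := contractive_bounded cT.
Let P (f : H) := f - T (adjoint T f).
Let A := sqrt_op P.

Let cTT : contractive_operator (fun f => T (adjoint T f)).
Proof.
have cT' := adjoint_contractive cT; split=> [c f f'|f].
  by rewrite cT'.1 bT.1.
exact: le_trans (cT.2 _) (cT'.2 _).
Qed.

Let sTT x y : rdot (T (adjoint T x)) y = rdot x (T (adjoint T y)).
Proof. by rewrite rdot_adjoint // rdotC -rdot_adjoint // rdotC. Qed.

Let pA : positive_operator A := (sqrt_opP cTT sTT).1.
Let AA x : A (A x) = x - T (adjoint T x) := (sqrt_opP cTT sTT).2 x.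
Let bA : bounded_operator A := pA.1.
Let sA x y : rdot (A x) y = rdot x (A y) := positive_operator_sym pA x y.

Let hnormA y : hnorm (A y) ^+ 2 = hnorm y ^+ 2 - hnorm (adjoint T y) ^+ 2.
Proof.
by rewrite -!rdotxx sA AA rdotBr -(rdot_adjoint bT) (rdotC (T _)).
Qed.

(** [lifted_norm_space] projects off Ker P but takes preimages under A; the two kernels agree
    because |A y|^2 = Re <P y, y>. *)
Let ker_sqrt : ker_op P = ker_op A.
Proof.
apply/seteqP; split=> y; rewrite /ker_op /=; last first.
  by move=> y0; rewrite /P -AA y0 (bounded_operator0 bA).
rewrite /P -AA => y0; apply: rdotxx_eq0.
by rewrite sA y0 rdotC rdot0l.
Qed.

(* [A] and [T] together form a coisometry [H x H0 -> H], because
   [A ^ 2 + T T^* = 1]. *)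
Let row_contractive x g :
  hnorm (A x + T g) ^+ 2 <= hnorm x ^+ 2 + hnorm g ^+ 2.
Proof.
set h := A x + T g.
have e : hnorm h ^+ 2 = rdot x (A h) + rdot g (adjoint T h).
  by rewrite -rdotxx {1}/h rdotDl sA rdot_adjoint.
(* As |A h|^2 + |T^* h|^2 = |h|^2, the two squares below add up to 2 |h|^2 <= |x|^2 + |g|^2 +
   |h|^2. *)
have := hnormA h.
have := sqr_ge0 (hnorm (x - A h)); rewrite sqr_hnormBr.
have := sqr_ge0 (hnorm (g - adjoint T h)); rewrite sqr_hnormBr.
by lra.
Qed.

(** With e = x - A y one has A x + T T^* y = y + A e, and the right-hand side is exactly |x|^2 -
    |e|^2 + |A e|^2: the test vector T^* y misses |x|^2 by at most |e|^2. *)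
Let almost_sup x y :
  hnorm x ^+ 2 - hnorm (x - A y) ^+ 2 <=
  hnorm (A x + T (adjoint T y)) ^+ 2 - hnorm (adjoint T y) ^+ 2.
Proof.
have [e eE] : exists e, x - A y = e by exists (x - A y).
have xE : x = A y + e by rewrite -eE addrC subrK.
rewrite eE.
have -> : A x + T (adjoint T y) = y + A e.
  by rewrite {1}xE (bounded_operatorD bA) AA addrAC subrK.
have : hnorm x ^+ 2 = hnorm (A y + e) ^+ 2 by rewrite -xE.
rewrite !sqr_hnormDr sA (hnormA y) => ->.
by have := sqr_ge0 (hnorm (A e)); lra.
Qed.

Definition complement_sqnorm (f : H) : \bar R :=
  ereal_sup [set (hnorm (f + T g) ^+ 2 - hnorm g ^+ 2)%:E | g in [set: H0]].

Let sqnorm_sqrt x (u : nat -> H) : A \o u @ \oo --> x ->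
  complement_sqnorm (A x) = (hnorm x ^+ 2)%:E.
Proof.
move=> ux; apply/le_anti/andP; split.
  apply: ge_ereal_sup => _ [g _ <-]; rewrite lee_fin.
  by have := row_contractive x g; lra.
have c1 : (fun n => hnorm x ^+ 2 - hnorm (A (u n) - x) ^+ 2) @ \oo --> hnorm x ^+ 2.
  rewrite -[X in _ --> X]subr0; apply: cvgB; first exact: cvg_cst.
  by rewrite -(mulr0 0); apply: cvgM; apply/cvg_hnormP.
have lb n : ((hnorm x ^+ 2 - hnorm (A (u n) - x) ^+ 2)%:E <= complement_sqnorm (A x))%E.
  apply: le_ereal_sup_tmp.
  exists (hnorm (A x + T (adjoint T (u n))) ^+ 2 - hnorm (adjoint T (u n)) ^+ 2)%:E.
    by exists (adjoint T (u n)).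
  by rewrite lee_fin (hnormBC (A (u n))); exact: almost_sup.
case: (complement_sqnorm (A x)) lb => [r lb||/(_ 0%N)//]; last by rewrite leey.
rewrite lee_fin; apply: (cvg_ler c1 (cvg_cst r)) => n.
by have := lb n; rewrite lee_fin.
Qed.

(** A range criterion in the style of Douglas. The functional y -> Re <y, f> factors through A, and
    its representing vector x satisfies <A y, x> = <y, f> in real parts, that is A x = f. *)
Let in_range_sqrt f (C : R) : (forall y, `|rdot y f| <= C * hnorm (A y)) ->
  exists x, (exists u : nat -> H, A \o u @ \oo --> x) /\ A x = f.
Proof.
move=> fC.
have [|t v w|t v w|t v w|v _|x [[u _ ux] xP]] := @energy_riesz R H H setT A
  (fun y => rdot y f) C => //.
- by rewrite (bounded_operatorD bA) (bounded_operatorZ bA).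
- by rewrite rdotDl rdotZl.
exists x; split; first by exists u.
by apply: rdot_ext => y; rewrite -sA xP.
Qed.

Let finite_sqnorm f : (complement_sqnorm f < +oo)%E ->
  exists x, (exists u : nat -> H, A \o u @ \oo --> x) /\ A x = f.
Proof.
move=> foo.
have [M fM] : exists M, forall g, hnorm (f + T g) ^+ 2 - hnorm g ^+ 2 <= M.
  have ub g : ((hnorm (f + T g) ^+ 2 - hnorm g ^+ 2)%:E <= complement_sqnorm f)%E.
    by apply: ereal_sup_ubound; exists g.
  case: (complement_sqnorm f) foo ub => [M _ ub|//|_ /(_ 0)//].
  by exists M => g; have := ub g; rewrite lee_fin.
have M0 : 0 <= M.
  have := fM 0; rewrite (bounded_operator0 bT) hnorm_zero addr0.
  by have := sqr_ge0 (hnorm f); lra.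
(* M + 1 pays for the part <f, T T^* y> and |f| for the part <A f, A y>. *)
apply: (@in_range_sqrt _ (M + 1 + hnorm f)) => y.
set a := hnorm (A y); have a0 : 0 <= a by exact: hnorm_ge0.
pose c := rdot f (T (adjoint T y)).
have key t : 2 * t * c <= M + t ^+ 2 * a ^+ 2.
  have := fM (t%:C *: adjoint T y).
  rewrite (bounded_operatorZ bT) sqr_hnormDr rdotZr -/c !hnorm_realZ_abs.
  rewrite !exprMn real_normK ?num_real //.
  have eT : hnorm (T (adjoint T y)) ^+ 2 =
      hnorm y ^+ 2 - 2 * a ^+ 2 + hnorm (A (A y)) ^+ 2.
    have -> : T (adjoint T y) = y + - A (A y) by rewrite AA opprB addrC subrK.
    by rewrite sqr_hnormDr hnorm_opp rdotNr -sA rdotxx -/a; ring.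
  have eA : a ^+ 2 = hnorm y ^+ 2 - hnorm (adjoint T y) ^+ 2 by rewrite hnormA.
  rewrite eT; have := sqr_ge0 (hnorm f).
  have := mulr_ge0 (sqr_ge0 t) (sqr_ge0 (hnorm (A (A y)))).
  have -> : hnorm (adjoint T y) ^+ 2 = hnorm y ^+ 2 - a ^+ 2 by lra.
  by move: (t ^+ 2) (hnorm y ^+ 2) (a ^+ 2) (hnorm (A (A y)) ^+ 2) => p q r s; lra.
(* If A y = 0 and c were not 0, then t = (M + 1) / (2 c) would give M + 1 <= M. Otherwise t = 1 / a
   and t = -1 / a bound c from both sides. *)
have ca : `|c| <= (M + 1) * a.
  have [a0'|a1] := eqVneq a 0.
    rewrite a0' mulr0 normr_le0; apply: contraT => c0.
    have := key ((M + 1) / (2 * c)); rewrite a0'.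
    have -> : 2 * ((M + 1) / (2 * c)) * c = M + 1 by field.
    by rewrite expr0n mulr0 addr0; lra.
  have ap : 0 < a by rewrite lt_neqAle eq_sym a1.
  have h1 := key a^-1; have h2 := key (- a^-1).
  rewrite sqrrN exprVn mulVf ?expf_neq0 // in h1 h2.
  have -> : c = (2 * a^-1 * c) / 2 * a by field.
  rewrite normrM (gtr0_norm ap) ler_pM2r // ler_norml.
  by move: h1 h2; rewrite mulrN mulNr; move: (2 * a^-1 * c) => d; lra.
have -> : rdot y f = c + rdot (A f) (A y).
  by rewrite sA AA rdotBr rdotC /c; lra.
apply: le_trans (ler_normD _ _) _.
have hA : hnorm (A f) <= hnorm f.
  rewrite -(@ler_pXn2r _ 2) ?nnegrE ?hnorm_ge0 // hnormA.
  by have := sqr_ge0 (hnorm (adjoint T f)); lra.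
have := rdot_CauchySchwarz (A f) (A y); rewrite -/a.
by have := ler_wpM2r a0 hA; lra.
Qed.

Lemma complement_lifted_norm :
  isometrically_equal
    (NormedSubmanifold [set f | (complement_sqnorm f < +oo)%E]
       (fun f => Num.sqrt (fine (complement_sqnorm f))))
    (lifted_norm_space P).
Proof.
(* An arbitrary preimage x0 is traded for one in the closure of the range of A; Cauchy-Schwarz
   provides the constant |x0|. *)
have rangeP f : range A f ->
    exists x, (exists u : nat -> H, A \o u @ \oo --> x) /\ A x = f.
  move=> [x0 _ <-]; apply: (@in_range_sqrt _ (hnorm x0)) => y.
  by rewrite -sA mulrC; exact: rdot_CauchySchwarz.
have car f : (complement_sqnorm f < +oo)%E <-> range A f.
  split=> [/finite_sqnorm[x [_ xf]]|/rangeP[x [[u ux] <-]]]; first by exists x.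
  by rewrite (sqnorm_sqrt ux) ltry.
split; first by apply/seteqP; split=> f /car.
move=> f /= /car fA; have [x [[u ux] xf]] := rangeP _ fA.
rewrite -{1}xf (sqnorm_sqrt ux) /= sqrtr_sqr ger0_norm ?hnorm_ge0 //.
congr hnorm; apply/esym.
set x0 := xget _ _.
have Ax0 : A x0 = f.
  have [z _ zf] := fA; exact: (xgetPex 0 (ex_intro (A @^-1` [set f]) z zf)).
(* x is the projection of x0: it differs from x0 by an element of Ker A and, being a limit of
   vectors A u_n with A symmetric, it is orthogonal to Ker A. *)
rewrite ker_sqrt; apply: orth_proj_complE; last first.
  by rewrite /ker_op /= (bounded_operatorB bA) Ax0 xf subrr.
apply/orth_complP => [c m|m].
  by rewrite /ker_op /= (bounded_operatorZ bA) => ->; rewrite scaler0.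
rewrite /ker_op /= => m0.
have h := cvg_rdotl m ux; rewrite (_ : (fun n => _) = fun=> 0) in h.
  by apply: (cvg_unique (@norm_hausdorff _ _) h); exact: cvg_cst.
by apply/funext => n /=; rewrite sA m0 rdotC rdot0l.
Qed.

End Complement.

(** When the square is expanded, only the term with conj(i^k) <x, y> survives multiplication by i^k;
    the others carry sums of i^k or of i^(2k) over four values of k, which vanish. *)
Lemma polarization (R : realType) (H : hilbertType R) (x y : H) :
  4^-1 * \sum_(k < 4) 'i ^+ k * (hnorm (x + 'i ^+ k *: y) ^+ 2)%:C = hdot x y.
Proof.
have e (c : R[i]) : (hnorm (x + c *: y) ^+ 2)%:C =
    hdot x x + c^* * hdot x y + c * hdot y x + c * c^* * hdot y y.
  have h1 z : hdot (x + c *: y) z = hdot x z + c * hdot y z.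
    by rewrite linearDl /= linearZl_LR.
  have h2 z : hdot z (x + c *: y) = hdot z x + c^* * hdot z y.
    by rewrite linearDr /= linearZr_LR.
  by rewrite -hdotxx_hnorm h1 !h2; ring.
have i2 : 'i * 'i = -1 :> R[i] by rewrite -expr2 sqrCi.
rewrite !big_ord_recl big_ord0 /= !e /bump /= expr0 expr1 !exprS expr0 mulr1.
rewrite i2 mulrN1 !rmorphN !rmorph1 /= !conjCi.
have n4 : (4 : R[i]) != 0 by rewrite pnatr_eq0.
apply: (canLR (mulKf n4)).
by ring: i2.
Qed.

(** * The pullback space and the adjoint of its inclusion *)

Section PullbackSpace.
Variables (R : realType) (H0 H : hilbertType R) (T : H0 -> H).
Hypothesis cT : contractive_operator T.
Let bT := contractive_bounded cT.
Let Q (x : H0) := orth_proj (orth_compl (ker_op T)) x.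

(** The functional v -> Re <v, x> on Ker T is represented by a limit q of elements of Ker T;
    continuity of T keeps q in the kernel, and x - q is the projection. *)
Let ker_projP x : orth_compl (ker_op T) (Q x) /\ T (Q x) = T x.
Proof.
have [|t v w Tv Tw|t v w|t v w|v _|q [[u Ku uq] qP]] := @energy_riesz R H0 H0 (ker_op T) id
  (fun v => rdot v x) (hnorm x) => //.
- exact: (bounded_operator0 bT).
- by rewrite /ker_op /= (bounded_operatorD bT) (bounded_operatorZ bT) Tv Tw scaler0 addr0.
- by rewrite rdotDl rdotZl.
- by rewrite mulrC; exact: rdot_CauchySchwarz.
have Tq : T q = 0.
  apply: (cvg_unique (@norm_hausdorff _ _) (bounded_operator_cvg bT uq)).
  by rewrite (_ : (fun n => _) = fun=> 0); [exact: cvg_cst|apply/funext => n; exact: Ku].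
have Kxq : orth_compl (ker_op T) (x - q).
  apply/orth_complP => [c m|m Km].
    by rewrite /ker_op /= (bounded_operatorZ bT) => ->; rewrite scaler0.
  by rewrite rdotC rdotBr qP // subrr.
have -> : Q x = x - q.
  by apply: orth_proj_complE => //; rewrite /ker_op /= opprB addrC subrK.
by split=> //; rewrite (bounded_operatorB bT) Tq subr0.
Qed.

Let ker_projE x p : orth_compl (ker_op T) p -> T p = T x -> Q x = p.
Proof.
move=> Kp Tp; apply: orth_proj_complE => //.
by rewrite /ker_op /= (bounded_operatorB bT) Tp subrr.
Qed.

Let ker_projD x c y : Q (x + c *: y) = Q x + c *: Q y.
Proof.
have [Kx Tx] := ker_projP x; have [Ky Ty] := ker_projP y.
apply: ker_projE; first by apply/orth_complD/orth_complZ.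
by rewrite !(bounded_operatorD bT) !(bounded_operatorZ bT) Tx Ty.
Qed.

Let pullback_norm x : nsnorm (pullback_space T) (T x) = hnorm (Q x).
Proof.
rewrite /=; set x0 := xget _ _.
have Tx0 : T x0 = T x.
  by apply: (xgetPex 0 (ex_intro (T @^-1` [set T x]) x _)).
rewrite -/(Q x0); congr hnorm; apply: ker_projE; have [Kx TQx] := ker_projP x => //.
by rewrite TQx.
Qed.

(** Q is real- and complex-linear and computes the norm, so polarization transports the inner
    product of the complement of Ker T to Ran T. *)
Let pullback_dot x y : nsdot (pullback_space T) (T x) (T y) = hdot (Q x) (Q y).
Proof.
rewrite -polarization /nsdot; congr (_ * _); apply: eq_bigr => k _.
by rewrite -bounded_operatorZ // -bounded_operatorD // pullback_norm ker_projD.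
Qed.

Let adjoint_ker_proj h : Q (adjoint T h) = adjoint T h.
Proof.
by apply: ker_projE => // m; rewrite /ker_op /= hdotC -adjointP // => ->;
  rewrite linear0l conjc0.
Qed.

(** T^* h is orthogonal to Ker T, hence <T x, h> = <Q x, T^* h>, which is the pullback inner product
    of T x with T T^* h. Uniqueness is also proved, since the adjoint is a chosen function. *)
Lemma inclusion_adjoint_pullback :
  inclusion_adjoint (pullback_space T) = fun h => T (adjoint T h).
Proof.
apply: xget_unique => [h|F FP].
  split; first by exists (adjoint T h).
  move=> _ [x _ <-]; rewrite pullback_dot adjoint_ker_proj -adjointP //.
  by rewrite (ker_projP x).2.
apply/funext => h; have [[v _ vh] dF] := FP h.
have e x : hdot (Q x) (Q v) = hdot (Q x) (adjoint T h).
  have := dF (T x) (imageT _ _); rewrite -vh pullback_dot => <-.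
  by rewrite -adjointP // (ker_projP x).2.
have Qv : Q v = adjoint T h.
  apply/eqP; rewrite -subr_eq0; apply/eqP/rdotxx_eq0.
  (* The difference is itself a value of Q, so the relation [e] may be tested against it. *)
  have zE : Q v - adjoint T h = Q (v + (-1) *: adjoint T h).
    by rewrite ker_projD adjoint_ker_proj scaleN1r.
  by rewrite {1}zE rdotBr /rdot e subrr.
by rewrite -Qv (ker_projP v).2.
Qed.

End PullbackSpace.

(** * Analytic Toeplitz operators *)

Lemma prim_root_exists (C : numClosedFieldType) n : (0 < n)%N ->
  exists w : C, n.-primitive_root w.
Proof.
move=> n0; have [s sE] := closed_field_poly_normal ('X^n - 1 : {poly C}).
rewrite (monicP (monicXnsubC _ n0)) scale1r in sE.
have root_s : all n.-unity_root s by apply/allP => z; rewrite -root_prod_XsubC -sE.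
have uniq_s : uniq s.
  by rewrite -separable_prod_XsubC -sE separable_Xn_sub_1 // pnatr_eq0 -lt0n.
have size_s : (n <= size s)%N by rewrite -ltnS -(size_prod_XsubC s id) -sE size_XnsubC.
by have /hasP[w _ wP] := has_prim_root n0 root_s uniq_s size_s; exists w.
Qed.

Lemma norm_prim_root (C : numClosedFieldType) n (w : C) :
  n.-primitive_root w -> `|w| = 1.
Proof.
move=> wP; have n0 := prim_order_gt0 wP; apply/eqP.
by rewrite -(pexpr_eq1 n0 (normr_ge0 w)) -normrX (prim_expr_order wP) normr1.
Qed.

(** Orthogonality of characters: for k distinct from l this is a geometric sum whose ratio is an
    n-th root of unity other than 1. *)
Lemma sum_prim_root_expr (C : numClosedFieldType) n (w : C) k l :
  n.-primitive_root w -> (k < n)%N -> (l < n)%N ->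
  \sum_(j < n) (w ^+ k * (w ^+ l)^*) ^+ j = if k == l then n%:R else 0.
Proof.
move=> wP kn ln; have w1 := norm_prim_root wP.
have cw : (w ^+ l)^* = (w ^+ l)^-1.
  by rewrite invC_norm normrX w1 !expr1n invr1 mul1r.
have wl : w ^+ l != 0 by rewrite expf_neq0 // -normr_gt0 w1.
rewrite cw; have [->|kl] := eqVneq k l.
  by rewrite mulfV //; under eq_bigr do rewrite expr1n; rewrite sumr_const card_ord.
set x := _ / _.
have x1 : x - 1 != 0.
  rewrite subr_eq0; apply: contra kl => /eqP xE.
  have : w ^+ k = w ^+ l by rewrite -[RHS]mul1r -xE divfK.
  by move/eqP; rewrite (eq_prim_root_expr wP) !modn_small.
apply: (mulfI x1); rewrite mulr0 -subrX1.
by rewrite exprMn -!exprM exprVn -!exprM mulnC exprM (mulnC l) exprM (prim_expr_order wP)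
  !expr1n invr1 mulr1 subrr.
Qed.

(** Parseval's identity for the discrete Fourier transform of vector coefficients. *)
Lemma sum_prim_root_hnorm (R : realType) (H : hilbertType R) n (w : R[i])
    (c : nat -> H) : n.-primitive_root w ->
  \sum_(j < n) hnorm (\sum_(0 <= k < n) (w ^+ j) ^+ k *: c k) ^+ 2 =
  n%:R * \sum_(0 <= k < n) hnorm (c k) ^+ 2.
Proof.
move=> wP; apply: complexI.
rewrite rmorph_sum rmorphM rmorph_nat rmorph_sum /=.
under eq_bigr do rewrite -hdotxx_hnorm big_mkord.
rewrite big_mkord.
transitivity (\sum_(j < n) \sum_(k < n) \sum_(l < n)
    (w ^+ k * (w ^+ l)^*) ^+ j * hdot (c k) (c l)).
  apply: eq_bigr => j _; rewrite linear_sumlz /=.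
  apply: eq_bigr => k _; rewrite linear_sumr /=.
  apply: eq_bigr => l _; rewrite linearZl_LR linearZr_LR /= mulrA; congr (_ * _).
  by rewrite exprMn -!rmorphXn -!exprM !(mulnC j).
rewrite exchange_big /= mulr_sumr; apply: eq_bigr => k _.
rewrite exchange_big /= (bigD1 k) //= -mulr_suml (sum_prim_root_expr wP) //.
rewrite eqxx hdotxx_hnorm [X in _ + X]big1 ?addr0 // => l lk.
rewrite -mulr_suml (sum_prim_root_expr wP) // ifF ?mul0r //.
by apply/negbTE; apply: contra lk => /eqP kl; apply/eqP/val_inj.
Qed.

Lemma sum_affine (R : pzRingType) n (c d : R) (F : 'I_n -> R) :
  \sum_j (c * F j + d) = c * \sum_j F j + n%:R * d.
Proof. by rewrite big_split /= sumr_const card_ord mulr_natl mulr_sumr. Qed.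

(** The cross term of (y + 2 e)^2 is absorbed by 4 e y <= e y^2 + 4 e, and e < 1 gives 4 e^2 <= 4
    e. *)
Lemma sqr_le_perturbation (R : realFieldType) (x y e : R) :
  0 <= x -> 0 <= y -> 0 < e -> e < 1 -> x <= y + 2 * e ->
  x ^+ 2 <= (1 + e) * y ^+ 2 + 8 * e.
Proof.
move=> x0 y0 e0 e1 xy.
have : x ^+ 2 <= (y + 2 * e) ^+ 2 by rewrite lerXn2r // nnegrE //; lra.
by have := mulr_ge0 (ltW e0) (sqr_ge0 (y - 2)); nra.
Qed.

(** * Coefficient bounds from pointwise bounds on circles *)

Section PowerSeriesBound.
Variables (R : realType).

(** At an intermediate radius s, with r < s < 1, the terms are bounded; comparison is with a
    geometric series of ratio r / s. *)
Lemma power_series_summable (V : normedModType R[i]) (b : nat -> V)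
    (h : unit_disk R -> V) (r : R) :
  has_power_series b h -> 0 <= r -> r < 1 ->
  cvgn (series (fun k => r ^+ k * hnorm (b k))).
Proof.
move=> bh r0 r1.
have [s [s0 s1 rs]] : exists s : R, [/\ 0 < s, s < 1 & r < s].
  by exists ((1 + r) / 2); split; lra.
have [z zE] := real_disk (ltW s0) s1.
have := cvg_series_cvg_0 (cvgP _ (bh z)); rewrite zE => /cvg_hnormP.
under eq_fun do rewrite subr0 hnorm_realZ ?(ltW s0)//.
move=> c0; have [M M0 bM] : exists2 M, 0 < M & forall k, s ^+ k * hnorm (b k) <= M.
  have := cvg_seq_bounded (cvgP _ c0) => -[M [_ /(_ (M + 1))]].
  rewrite ltrDl ltr01 => /(_ isT) bM; exists (`|M| + 2); first by have := normr_ge0 M; lra.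
  move=> k; have := bM k I => /=; have := ler_norm M.
  have := ler_norm (s ^+ k * hnorm (b k)); lra.
have : cvgn (series (geometric M (r / s))).
  apply: is_cvg_geometric_series.
  by rewrite ger0_norm ?(divr_ge0 r0 (ltW s0)) // ltr_pdivrMr // mul1r.
apply: series_le_cvg => k /=.
- by rewrite mulr_ge0 ?exprn_ge0 ?hnorm_ge0.
- by rewrite mulr_ge0 ?(ltW M0) ?exprn_ge0 ?divr_ge0 // ltW.
have sk : 0 < s ^+ k by rewrite exprn_gt0.
rewrite expr_div_n mulrCA ler_wpM2l ?exprn_ge0 // ler_pdivlMr // mulrC.
exact: bM.
Qed.

(** On the circle of radius r all tails are dominated by the same tail of the sum of r^k |b_k|, so
    one K works for every z. *)
Lemma power_series_uniform (V : normedModType R[i]) (b : nat -> V)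
    (h : unit_disk R -> V) (r e : R) :
  has_power_series b h -> 0 <= r -> r < 1 -> 0 < e ->
  \forall K \near \oo, forall z, `|val z| = r%:C ->
    hnorm (h z - \sum_(0 <= k < K) val z ^+ k *: b k) <= e.
Proof.
move=> bh r0 r1 e0; have cs := power_series_summable bh r0 r1.
have /cvgrPdist_le /(_ e e0) := cs.
apply: filterS => K hK z zr.
set t := series _ in cs hK.
have tK m : (K <= m)%N -> t m <= limn t.
  move=> _; apply: (nondecreasing_cvgn_le _ cs).
  by apply: nondecreasing_series => k _; rewrite mulr_ge0 ?exprn_ge0 ?hnorm_ge0.
have c1 : (fun m => hnorm (\sum_(0 <= k < K + m) val z ^+ k *: b k
    - \sum_(0 <= k < K) val z ^+ k *: b k)) @ \oo -->
    hnorm (h z - \sum_(0 <= k < K) val z ^+ k *: b k).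
  apply: cvg_hnorm; apply: cvgB; last exact: cvg_cst.
  have := bh z; rewrite -(cvg_shiftn K).
  rewrite (_ : [sequence _]_n =
    fun m => \sum_(0 <= k < K + m) val z ^+ k *: b k); first by [].
  by apply/funext => m; rewrite /series /= addnC.
apply: (cvg_ler c1 (cvg_cst e)) => m.
rewrite (big_cat_nat (n := K)) ?leq_addr //= addrAC subrr add0r.
apply: le_trans (hnorm_sum_le _ _ _) _.
have -> : \sum_(K <= k < K + m) hnorm (val z ^+ k *: b k) = t (K + m)%N - t K.
  rewrite /t /series /= [in RHS](big_cat_nat (n := K)) ?leq_addr //= addrAC subrr add0r.
  apply: eq_bigr => k _; rewrite hnormZ normrX zr -rmorphXn /=; by [].
have := tK (K + m)%N (leq_addr _ _).
have := ler_norm (limn t - t K); lra.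
Qed.

Lemma power_series_hnorm_le (V : normedModType R[i]) (b : nat -> V)
    (h : unit_disk R -> V) (M : R) z :
  has_power_series b h -> (forall k, hnorm (b k) <= M) ->
  hnorm (h z) <= M / (1 - complex.Re `|val z|).
Proof.
move=> bh bM; set r := complex.Re _.
have rE : r%:C = `|val z| by apply: RRe_real; rewrite normr_real.
have r0 : 0 <= r by rewrite -ler0c rE.
have r1 : r < 1 by rewrite -ltcR rE; exact: (valP z).
have M0 : 0 <= M by apply: le_trans (bM 0%N); exact: hnorm_ge0.
apply: (cvg_ler (cvg_hnorm _ (bh z)) (cvg_cst _)) => n.
apply: le_trans (hnorm_sum_le _ _ _) _.
apply: (@le_trans _ _ (\sum_(0 <= k < n) M * r ^+ k)).
  apply: ler_sum => k _; rewrite hnormZ normrX -rE -rmorphXn /= mulrC.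
  by rewrite ler_wpM2r ?exprn_ge0.
rewrite -mulr_sumr ler_wpM2l // -[leRHS]mul1r ler_pdivlMr; last lra.
have := subrX1 r n; rewrite big_mkord => h1.
have := exprn_ge0 n r0; lra.
Qed.

(** The roots of unity average only polynomials exactly, so p and h are replaced on the circle by
    partial sums of a common length K. This spoils the pointwise inequality by an error e, removed
    by letting e tend to 0; r then tends to 1. *)
Lemma power_series_sum_sqr_le (U Y : hilbertType R) (a : nat -> U) (b : nat -> Y)
    (p : unit_disk R -> U) (h : unit_disk R -> Y) (M : R) :
  has_power_series a p -> has_power_series b h ->
  (forall z, hnorm (h z) <= hnorm (p z)) ->
  (forall n, \sum_(0 <= k < n) hnorm (a k) ^+ 2 <= M) ->
  forall n, \sum_(0 <= k < n) hnorm (b k) ^+ 2 <= M.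
Proof.
move=> ap bh hp aM L.
have M0 : 0 <= M by have := aM 0%N; rewrite big_geq.
have scal r n (V : hilbertType R) (c : nat -> V) : 0 <= r ->
    \sum_(0 <= k < n) hnorm (r%:C ^+ k *: c k) ^+ 2 =
    \sum_(0 <= k < n) (r ^+ 2) ^+ k * hnorm (c k) ^+ 2.
  by move=> r0; apply: eq_bigr => k _; rewrite hnorm_realZ // exprMn -!exprM mulnC.
have step1 r e : 0 <= r -> r < 1 -> 0 < e -> e < 1 ->
    \sum_(0 <= k < L) (r ^+ 2) ^+ k * hnorm (b k) ^+ 2 <= (1 + e) * M + 8 * e.
  move=> r0 r1 e0 e1.
  have ua := power_series_uniform ap r0 r1 e0.
  have ub := power_series_uniform bh r0 r1 e0.
  (* K makes both partial sums accurate to within e, includes all indices below L, and is positive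
     so that a primitive root exists. *)
  have [K [[{}ua {}ub] LK]] : exists K, ((forall z, `|val z| = r%:C ->
     hnorm (p z - \sum_(0 <= k < K) val z ^+ k *: a k) <= e) /\
     (forall z, `|val z| = r%:C ->
     hnorm (h z - \sum_(0 <= k < K) val z ^+ k *: b k) <= e)) /\ (L.+1 <= K)%N.
    near \oo => K; exists K; split; first split.
    - by near: K.
    - by near: K.
    - by near: K; exact: nbhs_infty_ge.
  have K0 : (0 < K)%N by apply: leq_trans LK.
  have [w wP] := @prim_root_exists R[i] K K0.
  have w1 := norm_prim_root wP.
  have zn j : `|r%:C * w ^+ j| = r%:C.
    by rewrite normrM normrX w1 expr1n mulr1 ger0_norm // ler0c.
  have zd j : `|r%:C * w ^+ j| < 1 :> R[i] by rewrite zn (_ : 1 = 1%:C) // ltcR.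
  pose z j : unit_disk R := exist (fun x : R[i] => `|x| < 1) _ (zd j).
  have ev (V : hilbertType R) (c : nat -> V) j :
      \sum_(0 <= k < K) val (z j) ^+ k *: c k =
      \sum_(0 <= k < K) (w ^+ j) ^+ k *: (r%:C ^+ k *: c k).
    by apply: eq_bigr => k _; rewrite scalerA /= exprMn mulrC.
  have sa := sum_prim_root_hnorm (fun k => r%:C ^+ k *: a k) wP.
  have sb := sum_prim_root_hnorm (fun k => r%:C ^+ k *: b k) wP.
  rewrite scal // in sa; rewrite scal // in sb.
  have pt j : hnorm (\sum_(0 <= k < K) (w ^+ j) ^+ k *: (r%:C ^+ k *: b k)) ^+ 2 <=
     (1 + e) * hnorm (\sum_(0 <= k < K) (w ^+ j) ^+ k *: (r%:C ^+ k *: a k)) ^+ 2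
     + 8 * e.
    rewrite -!ev; have := ua _ (zn j : `|val (z j)| = _).
    have := ub _ (zn j : `|val (z j)| = _).
    set hK := \sum_(0 <= k < K) _ *: b k; set pK := \sum_(0 <= k < K) _ *: a k.
    have h1 := ler_hnormD (h (z j)) (hK - h (z j)); have h2 := ler_hnormD pK (p (z j) - pK).
    rewrite addrC subrK in h1; rewrite addrC subrK in h2.
    rewrite (hnormBC (h _)) => h3 h4; have h5 := hp (z j).
    apply: sqr_le_perturbation; rewrite ?hnorm_ge0 //.
    apply: le_trans h1 _; rewrite [2](_ : 2 = 1 + 1) // mulrDl mul1r addrA lerD //.
    by apply: le_trans h5 _; apply: le_trans h2 _; rewrite lerD2l.
  have avg : \sum_(0 <= k < K) (r ^+ 2) ^+ k * hnorm (b k) ^+ 2 <=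
     (1 + e) * \sum_(0 <= k < K) (r ^+ 2) ^+ k * hnorm (a k) ^+ 2 + 8 * e.
    have KR : 0 < K%:R :> R by rewrite ltr0n.
    rewrite -(ler_pM2l KR) -sb mulrDr mulrCA -sa.
    rewrite [leRHS](_ : _ = \sum_(j < K) ((1 + e) * hnorm (\sum_(0 <= k < K)
        (w ^+ j) ^+ k *: (r%:C ^+ k *: a k)) ^+ 2 + 8 * e)).
      by apply: ler_sum => j _; exact: pt.
    by rewrite sum_affine.
  apply: (@le_trans _ _ (\sum_(0 <= k < K) (r ^+ 2) ^+ k * hnorm (b k) ^+ 2)).
    rewrite (big_cat_nat (n := L) (p := K)) //=; last exact: ltnW.
    rewrite lerDl sumr_ge0 // => k _.
    by apply: mulr_ge0; [apply/exprn_ge0/sqr_ge0|exact: sqr_ge0].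
  apply: le_trans avg _; rewrite lerD2r ler_pM2l; last lra.
  apply: le_trans (aM K); apply: ler_sum => k _.
  rewrite ler_piMl ?sqr_ge0 // exprn_ile1 ?sqr_ge0 // exprn_ile1 // ltW //.
have step2 r : 0 <= r -> r < 1 ->
    \sum_(0 <= k < L) (r ^+ 2) ^+ k * hnorm (b k) ^+ 2 <= M.
  move=> r0 r1; apply/ler_addgt0Pr => e e0.
  (* (1 + d) M + 8 d = M + d (M + 8), so the second entry keeps the excess below e; the first keeps
     d < 1. *)
  pose d := Num.min (2^-1) (e / (M + 8)).
  have M8 : 0 < M + 8 by lra.
  have d0 : 0 < d by rewrite lt_min divr_gt0 // andbT; lra.
  have d1 : d < 1 by rewrite gt_min; apply/orP; left; lra.
  have de : d * (M + 8) <= e by rewrite -ler_pdivlMr // ge_min lexx orbT.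
  by apply: le_trans (step1 r d r0 r1 d0 d1) _; lra.
pose r n : R := 1 - n.+1%:R^-1.
have rc : (fun n => \sum_(0 <= k < L) (r n ^+ 2) ^+ k * hnorm (b k) ^+ 2) @ \oo -->
   \sum_(0 <= k < L) hnorm (b k) ^+ 2.
  have r1 : r @ \oo --> (1 : R).
    rewrite -[X in _ --> X]subr0; apply: cvgB; [exact: cvg_cst|exact: cvg_harmonic].
  elim: (L) => [|n IHn].
    by rewrite big_geq //; under eq_fun do rewrite big_geq //; exact: cvg_cst.
  rewrite big_nat_recr //=; under eq_fun do rewrite big_nat_recr //=.
  apply: cvgD => //; rewrite -[X in _ --> X]mul1r.
  apply: cvgM; last exact: cvg_cst.
  under eq_fun do rewrite -exprM.
  rewrite -(expr1n R (2 * n)).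
  exact: (continuous_cvg _ (@exprn_continuous R (2 * n) 1) r1).
apply: (cvg_ler rc (cvg_cst M)) => n; apply: step2.
  by rewrite subr_ge0 invf_le1 ?ltr0n // ler1n.
by rewrite ltrBlDr ltrDl invr_gt0.
Unshelve. all: by end_near.
Qed.

End PowerSeriesBound.

(** * Coefficients of S f and contractivity of multiplication by S *)

Section Toeplitz.
Variables (R : realType) (U Y : hilbertType R) (S : unit_disk R -> U -> Y).
Hypothesis schurS : schur_class S.

Let bS z : bounded_operator (S z) := contractive_bounded (schurS.2 z).

Lemma schur_class_power_series : exists A : nat -> U -> Y,
  (forall k, bounded_operator (A k)) /\
  forall u, has_power_series (fun k => A k u) (fun z => S z u).
Proof.
have [A [bA AS]] := schurS.1; exists A; split=> // u z; apply/cvg_hnormP.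
apply/cvgrPdist_le => e e0.
have u1 : 0 < hnorm u + 1 by rewrite ltr_wpDl ?hnorm_ge0.
have e1 : 0 < e / (hnorm u + 1) by rewrite divr_gt0.
apply: filterS (AS z _ e1) => n /(_ u) h.
rewrite sub0r normrN ger0_norm ?hnorm_ge0 // hnormBC.
apply: le_trans h _; rewrite mulrAC ler_pdivrMr // ler_pM2l // lerDl //.
Qed.

Variable A : nat -> U -> Y.
Hypothesis bA : forall k, bounded_operator (A k).
Hypothesis AS : forall u, has_power_series (fun k => A k u) (fun z => S z u).
Implicit Types a b : nat -> U.

(** The expected Taylor coefficients of z -> S(z) f(z). The n-th one involves only the first n + 1
    coefficients of f, which makes truncation possible. *)
Definition cauchy_prod a (n : nat) : Y := \sum_(0 <= m < n.+1) A (n - m) (a m).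

Lemma cauchy_prodD a b n :
  cauchy_prod (fun m => a m + b m) n = cauchy_prod a n + cauchy_prod b n.
Proof.
rewrite /cauchy_prod -big_split /=; apply: eq_bigr => m _.
by rewrite bounded_operatorD.
Qed.

Definition monomial (N : nat) (u : U) (m : nat) : U := if m == N then u else 0.

Lemma cauchy_prod_monomial N u n :
  cauchy_prod (monomial N u) n = if (N <= n)%N then A (n - N) u else 0.
Proof.
rewrite /cauchy_prod /monomial; case: leqP => Nn.
  rewrite big_mkord (bigD1 (Ordinal (Nn : (N < n.+1)%N))) //= eqxx big1 ?addr0 //.
  move=> i iN; rewrite ifN ?(bounded_operator0 (bA _)) //.
rewrite big_nat big1 // => m /andP[_ mn].
by rewrite ifN ?(bounded_operator0 (bA _)) // ltn_eqF // (leq_trans mn).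
Qed.

Lemma power_series_shift (V : normedModType R[i]) (c : nat -> V) h N :
  has_power_series c h ->
  has_power_series (fun n => if (N <= n)%N then c (n - N)%N else 0)
    (fun z => val z ^+ N *: h z).
Proof.
move=> ch z; rewrite -(cvg_shiftn N).
rewrite (_ : [sequence _]_n =
  fun n => val z ^+ N *: series (fun k => val z ^+ k *: c k) n).
  by apply: cvgZr; exact: ch.
apply/funext => n; rewrite /series /= addnC (big_cat_nat (n := N)) ?leq_addr //=.
rewrite big_nat big1 ?add0r; last first.
  by move=> k /andP[_ kN]; rewrite leqNgt kN scaler0.
rewrite -{1}(add0n N) big_addn addKn scaler_sumr; apply: eq_bigr => k _.
by rewrite leq_addl addnK exprD scalerA mulrC.
Qed.

Definition truncate N a (m : nat) : U := if (m < N)%N then a m else 0.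

Lemma truncateS N a :
  truncate N.+1 a = fun m => truncate N a m + monomial N (a N) m.
Proof.
apply/funext => m; rewrite /truncate /monomial ltnS leq_eqVlt.
by have [->|] := eqVneq m N; rewrite ?ltnn ?add0r ?addr0.
Qed.

Lemma truncate_power_series N a :
  has_power_series (truncate N a) (fun z => \sum_(0 <= m < N) val z ^+ m *: a m).
Proof.
move=> z; apply/cvg_hnormP/cvgrPdist_le => e e0.
exists N => // n /= Nn; rewrite sub0r normrN ger0_norm ?hnorm_ge0 //.
rewrite /series /= (big_cat_nat (n := N)) //=.
rewrite [X in _ + X - _]big_nat [X in _ + X - _]big1; last first.
  by move=> k /andP[Nk _]; rewrite /truncate ltnNge Nk scaler0.
rewrite addr0 [X in X - _](_ : _ = \sum_(0 <= m < N) val z ^+ m *: a m).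
  by rewrite subrr hnorm_zero ltW.
by rewrite !big_mkord; apply: eq_bigr => k _; rewrite /truncate ltn_ord.
Qed.

(** Adding one monomial at a time adds the series of S(z) a_N shifted by N places, so no double
    series has to be rearranged. *)
Lemma cauchy_prod_truncate_power_series N a :
  has_power_series (cauchy_prod (truncate N a))
    (fun z => S z (\sum_(0 <= m < N) val z ^+ m *: a m)).
Proof.
elim: N => [|N IHN].
  move=> z; rewrite big_geq // (bounded_operator0 (bS _)).
  rewrite (_ : series _ = fun=> 0); first exact: cvg_cst.
  apply/funext => n; rewrite /series /= big1 // => k _.
  by rewrite /cauchy_prod big1 ?scaler0 // => m _; rewrite (bounded_operator0 (bA _)).
have h := has_power_seriesD IHN (power_series_shift (N := N) (@AS (a N))).
move=> z; rewrite big_nat_recr //= (bounded_operatorD (bS _)) (bounded_operatorZ (bS _)).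
rewrite (_ : cauchy_prod _ = fun k => cauchy_prod (truncate N a) k +
  (if (N <= k)%N then A (k - N) (a N) else 0)); first exact: h.
by apply/funext => n; rewrite truncateS cauchy_prodD cauchy_prod_monomial.
Qed.

(** The first n Cauchy coefficients do not change when the sequence is truncated at n. For a
    polynomial the product with S is already known to be a power series, and contractivity of each
    S(z) gives the pointwise bound on norms. *)
Lemma cauchy_prod_sum_sqr_le a (M : R) :
  (forall n, \sum_(0 <= k < n) hnorm (a k) ^+ 2 <= M) ->
  forall n, \sum_(0 <= k < n) hnorm (cauchy_prod a k) ^+ 2 <= M.
Proof.
move=> aM n.
have -> : \sum_(0 <= k < n) hnorm (cauchy_prod a k) ^+ 2 =
    \sum_(0 <= k < n) hnorm (cauchy_prod (truncate n a) k) ^+ 2.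
  rewrite !big_mkord; apply: eq_bigr => k _; congr (hnorm _ ^+ 2).
  rewrite /cauchy_prod !big_mkord; apply: eq_bigr => m _.
  by rewrite /truncate (leq_trans (ltn_ord m)).
have tM K : \sum_(0 <= k < K) hnorm (truncate n a k) ^+ 2 <= M.
  apply: le_trans (aM K); apply: ler_sum => k _; rewrite /truncate.
  by case: ifP => // _; rewrite hnorm_zero expr0n sqr_ge0.
have Sle z : hnorm (S z (\sum_(0 <= m < n) val z ^+ m *: a m)) <=
    hnorm (\sum_(0 <= m < n) val z ^+ m *: a m) by exact: (schurS.2 z).2.
exact: (power_series_sum_sqr_le (@truncate_power_series n a)
  (@cauchy_prod_truncate_power_series n a) Sle tM).
Qed.

(** Square summability already makes the Cauchy coefficients the series of some g. At each z the
    products of S with the partial sums of f tend to g(z), since the coefficients of the difference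
    are at most the square root of a tail of |f|^2, and to S(z) f(z), by continuity of S(z). *)
Lemma cauchy_prod_power_series (f : hardy U) :
  has_power_series (cauchy_prod (taylor f)) (fun z => S z (f z)).
Proof.
set a := taylor f; have sa := @taylor_summable _ _ f.
have aM n := square_summable_sum_le n sa.
have [g ag] := square_summable_power_series (square_summable_le (cauchy_prod_sum_sqr_le aM)).
suff gE z : g z = S z (f z) by move=> z; rewrite -gE; exact: ag.
pose w N := S z (\sum_(0 <= m < N) val z ^+ m *: a m).
have wS : w @ \oo --> S z (f z) by apply: (bounded_operator_cvg (bS z)); exact: (@taylorP _ _ f z).
apply: (cvg_unique (@norm_hausdorff _ _) _ wS); apply/cvg_hnormP.
set s := series (fun k => hnorm (taylor f k) ^+ 2) in aM.
have sN N : 0 <= limn s - s N by rewrite subr_ge0; exact: aM.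
have tail N n : \sum_(0 <= k < n) hnorm (a k - truncate N a k) ^+ 2 <= limn s - s N.
  have [nN|Nn] := leqP n N.
    rewrite big_nat big1 // => k /andP[_ kn].
    by rewrite /truncate (leq_trans kn) // subrr hnorm_zero expr0n.
  rewrite (big_cat_nat (n := N)) ?(ltnW Nn) //= big_nat big1 ?add0r; last first.
    by move=> k /andP[_ kn]; rewrite /truncate kn subrr hnorm_zero expr0n.
  rewrite lerBrDl; apply: le_trans (aM n).
  rewrite [leRHS](big_cat_nat (n := N)) ?(ltnW Nn) //= lerD2l.
  rewrite big_nat [leRHS]big_nat; apply: ler_sum => k /andP[Nk _].
  by rewrite /truncate ltnNge Nk subr0.
have e N : has_power_series (fun n => cauchy_prod a n + -1 *: cauchy_prod (truncate N a) n)
    (g \+ (fun z => -1 *: S z (\sum_(0 <= m < N) val z ^+ m *: a m))).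
  exact: (has_power_seriesD ag (has_power_seriesZ (-1)
    (@cauchy_prod_truncate_power_series N a))).
have co N n : hnorm (cauchy_prod a n + -1 *: cauchy_prod (truncate N a) n) <=
    Num.sqrt (limn s - s N).
  have -> : cauchy_prod a n + -1 *: cauchy_prod (truncate N a) n =
      cauchy_prod (fun k => a k - truncate N a k) n.
    rewrite scaleN1r; apply/eqP; rewrite subr_eq -cauchy_prodD; apply/eqP.
    by congr (cauchy_prod _ n); apply/funext => k; rewrite subrK.
  rewrite -(@ler_pXn2r _ 2) ?nnegrE ?hnorm_ge0 ?sqrtr_ge0 // sqr_sqrtr //.
  apply: le_trans (cauchy_prod_sum_sqr_le (tail N) n.+1).
  by rewrite big_nat_recr //= lerDr sumr_ge0 // => k _; rewrite sqr_ge0.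
have bd N : hnorm (w N - g z) <=
    Num.sqrt (limn s - s N) / (1 - complex.Re `|val z|).
  have := power_series_hnorm_le z (e N) (co N).
  by rewrite /= scaleN1r hnormBC.
have s0 : (fun N => Num.sqrt (limn s - s N) / (1 - complex.Re `|val z|)) @ \oo --> (0 : R).
  rewrite -(mul0r (1 - complex.Re `|val z|)^-1); apply: cvgM; last exact: cvg_cst.
  rewrite -(sqrtr0 R).
  have h : (fun N => limn s - s N) @ \oo --> (0 : R).
    by rewrite -(subrr (limn s)); apply: cvgB; [exact: cvg_cst|exact: sa].
  exact: (continuous_cvg _ (@sqrt_continuous R 0) h).
apply: (squeeze_cvgr _ (cvg_cst 0) s0).
by apply: nearW => N; rewrite hnorm_ge0 /=; exact: bd.
Qed.

Lemma toeplitzP (f : hardy U) :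
  (forall z, toeplitz S f z = S z (f z)) /\ hnorm (toeplitz S f) <= hnorm f.
Proof.
have aM n := hnorm_taylor_sum_le f n.
have gM := cauchy_prod_sum_sqr_le aM.
have gP : (fun z => S z (f z)) \in hardy_pred Y.
  apply/asboolP; exists (cauchy_prod (taylor f)); first exact: cauchy_prod_power_series.
  exact: square_summable_le gM.
(* The product has been shown to lie in the Hardy space, so the choice in [toeplitz] does not fall
   back on its default 0. *)
have tE : forall z, toeplitz S f z = S z (f z).
  exact: (xgetPex 0 (ex_intro [set g : hardy Y | forall z, g z = S z (f z)]
    (Hardy gP) (fun=> erefl))).
split=> //; apply: hnorm_hardy_le => [|n]; first exact: hnorm_ge0.
rewrite (@taylorE _ _ _ (cauchy_prod (taylor f))); first exact: gM.
by move=> z; rewrite tE; exact: cauchy_prod_power_series.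
Qed.

End Toeplitz.

Lemma toeplitz_contractive (R : realType) (U Y : hilbertType R)
    (S : unit_disk R -> U -> Y) :
  schur_class S -> contractive_operator (toeplitz S).
Proof.
move=> schurS; have [A [bA AS]] := schur_class_power_series schurS.
have tP := toeplitzP schurS bA AS.
split=> [c f g|f]; last exact: (tP f).2.
apply: val_inj; apply/funext => z.
by rewrite [LHS](tP _).1 (schurS.2 z).1 -(tP f).1 -(tP g).1.
Qed.

Theorem proposition3p6 (R : realType) (U Y : hilbertType R)
    (S : unit_disk R -> U -> Y)
    (sepU : separable_space U) (sepY : separable_space Y)
    (schurS : schur_class S) :
  isometrically_equal (dBR_space S)
    (lifted_norm_space
       (fun f => f - toeplitz S (adjoint (toeplitz S) f))) /\
  isometrically_equal (dBR_space S)
    (brangesian_complement (pullback_space (toeplitz S))).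
Proof.
have cT := toeplitz_contractive schurS.
(* By unfolding, [dBR_space S] is the space defined by [complement_sqnorm (toeplitz S)]; the second
   claim becomes the first once the adjoint of the inclusion is computed. *)
have h := complement_lifted_norm cT.
by split; last rewrite /brangesian_complement inclusion_adjoint_pullback.
Qed.
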